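(* Let $t\in\{5,7,11,17,19\}$, let $C^{(t)}(\zeta;q)$ be the two-variable crank generating function for $t$-core partitions, and let $\mathcal{C}^{(t)}_{2s}(q)$ denote its normalized $2s$-th moment generating function. Define $$\mathcal{R}_t=\begin{cases}\{2,4\}, & t=5,7,\\ \{2,4,8,10\}, & t=11,\\ \{2,4,8,10,14,16\}, & t=17,19,\end{cases}$$ and, for every integer $k\ge 1$, $$A^{(t)}_{2k}(\tau)=-\Big(\sum_{r\in\mathcal{R}_t}r^{2k}\Big)\sum_{m=1}^{\infty}m^{2k-1}\frac{q^{tm}}{1-q^{tm}},\qquad D^{(t)}_{2k}(\tau)=A^{(t)}_{2k}(\tau)+G_{2k}(\tau),$$ with $D^{(t)}_{j}(\tau)=0$ for odd $j$. Then for every positive integer $s$, $$\mathcal{C}^{(t)}_{2s}(q)=\operatorname{Tr}_s\Big(\Psi_T;\ D^{(t)}_2+\frac{B_2}{4},\ D^{(t)}_4+\frac{B_4}{8},\ \ldots,\ D^{(t)}_{2s}+\frac{B_{2s}}{4s}\Big)$$ and $$D^{(t)}_{2s}=-\frac{B_{2s}}{4s}+\operatorname{Tr}_s\Big(\Psi_V;\ \mathcal{C}^{(t)}_2(q),\ \mathcal{C}^{(t)}_4(q),\ \ldots,\ \mathcal{C}^{(t)}_{2s}(q)\Big).$$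
   Context: Here $q=e^{2\pi i\tau}$ with $\operatorname{Im}\tau>0$ (so $|q|<1$), and $B_k$ denotes the $k$-th Bernoulli number. Crank generating functions. Write $(1-\zeta^{\pm k}q^n)=(1-\zeta^kq^n)(1-\zeta^{-k}q^n)$. The crank generating function for $t$-core partitions is $$C^{(t)}(\zeta;q)=\prod_{n=1}^{\infty}\frac{(1-q^n)(1-q^{tn})^{e_t}\prod_{r\in\mathcal{R}_t}(1-\zeta^{\pm r}q^{tn})}{(1-\zeta^{\pm1}q^n)},$$ with $\mathcal{R}_t$ as in the claim and $e_5=1$, $e_7=3$, $e_{11}=3$, $e_{17}=5$, $e_{19}=7$. In particular $C^{(t)}(1;q)=\prod_{n\ge1}(1-q^{tn})^t/(1-q^n)$, which is the generating function of $t$-core partitions. Normalized moments. For $r\ge0$, $$\mathcal{C}^{(t)}_{r}(q)=\frac{1}{C^{(t)}(1;q)}\left.\Big(\zeta\frac{\partial}{\partial\zeta}\Big)^{r}C^{(t)}(\zeta;q)\right|_{\zeta=1}.$$ Equivalently, if $C^{(t)}(\zeta;q)=\sum_{n\ge0}\sum_{m\in\mathbb{Z}}M^{(t)}(m,n)\zeta^mq^n$, then $\mathcal{C}^{(t)}_r(q)=C^{(t)}(1;q)^{-1}\sum_{n\ge0}\sum_{m\in\mathbb{Z}}m^rM^{(t)}(m,n)q^n$. Eisenstein series. For $k\ge1$, $G_{2k}(\tau)=-\frac{B_{2k}}{4k}+\sum_{n\ge1}\sigma_{2k-1}(n)q^n$, where $\sigma_{j}(n)=\sum_{d\mid n}d^{j}$;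 $G_{j}=0$ for odd $j$. Partition traces. A partition $\beta$ of $s$ is written $\beta=(1^{m_1},2^{m_2},\ldots,s^{m_s})\vdash s$, where $m_k\ge0$ is the multiplicity of the part $k$ (so $\sum_k k\,m_k=s$), and $\ell(\beta)=m_1+\cdots+m_s$. For a function $\Psi$ on partitions and quantities $F_1,\ldots,F_s$, $$\operatorname{Tr}_s(\Psi;F_1,\ldots,F_s)=\sum_{\beta\vdash s}\Psi(\beta)\prod_{k=1}^sF_k^{m_k}.$$ For $\beta=(1^{m_1},\ldots,s^{m_s})\vdash s$, $$\Psi_T(\beta)=(2s)!\prod_{k=1}^s\frac{2^{m_k}}{m_k!\,((2k)!)^{m_k}},\qquad \Psi_V(\beta)=\frac{(2s)!}{2}(-1)^{\ell(\beta)-1}(\ell(\beta)-1)!\prod_{k=1}^s\frac{1}{m_k!\,((2k)!)^{m_k}}.$$ *)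

(* Defs.v *)
From HB Require Import structures.
From mathcomp Require Import all_boot all_order all_algebra.
From mathcomp Require Export complex.
From mathcomp Require Import all_classical all_reals all_analysis.

Set Implicit Arguments.
Unset Strict Implicit.
Unset Printing Implicit Defensive.

Import Order.TTheory GRing.Theory Num.Theory.
Import numFieldNormedType.Exports.

Local Open Scope classical_set_scope.
Local Open Scope ring_scope.
Local Open Scope complex_scope.

(* [R[i]] has no canonical topology of its own, but a [numFieldType] has one,
   induced by its norm.  Limits and derivatives are therefore written over a
   [numFieldType] K; everything is meant to be used with K := R[i], where the
   norm is the complex modulus and [derive1] is the complex derivative. *)

Section ComplexExponential.
Variable R : realType.

Definition cexp (z : R[i]) : R[i] :=
  (expR (complex.Re z))%:C * (cos (complex.Im z) +i* sin (complex.Im z)).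

Definition nome (tau : R[i]) : R[i] := cexp (2 * pi%:C * 'i%C * tau).

End ComplexExponential.

(* B_0, ..., B_n, from the recurrence
     \sum_(k < n.+2) 'C(n.+2, k) * B_k = 0. *)
Fixpoint bernoulli_seq (n : nat) : seq rat :=
  if n is n'.+1 then
    let s := bernoulli_seq n' in
    rcons s (- (n'.+2%:R)^-1 * \sum_(k < n'.+1) 'C(n'.+2, k)%:R * s`_k)
  else [:: 1].

Definition bernoulli (n : nat) : rat := (bernoulli_seq n)`_n.

Definition sigma (j n : nat) : nat := (\sum_(d <- divisors n) d ^ j)%N.

Definition crank_e (t : nat) : nat :=
  match t with
  | 5 => 1
  | 7 => 3
  | 11 => 3
  | 17 => 5
  | 19 => 7
  | _ => 0 (* outside the domain of the definition *)
  end%N.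

Definition crank_R (t : nat) : seq nat :=
  match t with
  | 5 | 7 => [:: 2; 4]
  | 11 => [:: 2; 4; 8; 10]
  | 17 | 19 => [:: 2; 4; 8; 10; 14; 16]
  | _ => [::] (* outside the domain of the definition *)
  end%N.

Section Crank.
Variable K : numFieldType.
Implicit Types (z q : K) (t j n r : nat).

Definition crank_factor t z q n : K :=
  (1 - q ^+ n) * (1 - q ^+ (t * n)) ^+ crank_e t
  * (\prod_(r <- crank_R t)
       ((1 - z ^+ r * q ^+ (t * n)) * (1 - z ^- r * q ^+ (t * n))))
  / ((1 - z * q ^+ n) * (1 - z^-1 * q ^+ n)).

Definition crank_gf t z q : K :=
  limn (fun N => \prod_(1 <= n < N.+1) crank_factor t z q n).

Definition zddz (f : K -> K) : K -> K := fun z => z * derive1 f z.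

Definition crank_moment t r q : K :=
  (crank_gf t 1 q)^-1 * iter r zddz (fun z => crank_gf t z q) 1.

(* For even j = 2k, the constant term B_j / (2j) is B_{2k} / (4k). *)
Definition eisenstein_G j q : K :=
  if odd j then 0 else
  - (ratr (bernoulli j) / (2 * j)%:R)
  + limn (fun N => \sum_(1 <= n < N.+1) (sigma j.-1 n)%:R * q ^+ n).

Definition crank_A t j q : K :=
  - (\sum_(r <- crank_R t) (r ^ j)%:R)
  * limn (fun N => \sum_(1 <= m < N.+1)
       (m ^ j.-1)%:R * (q ^+ (t * m) / (1 - q ^+ (t * m)))).

Definition crank_D t j q : K :=
  if odd j then 0 else crank_A t j q + eisenstein_G j q.

End Crank.

(* A partition (1^{m_1}, ..., s^{m_s}) of s is given by its multiplicities,
   with m_k stored at the ordinal k - 1; bounding them by s loses nothing,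
   since \sum_k k * m_k = s forces m_k <= s. *)
Definition multiplicities (s : nat) := {ffun 'I_s -> 'I_s.+1}.

Definition is_partition s (m : multiplicities s) : bool :=
  (\sum_(k < s) k.+1 * m k == s)%N.

Definition part_length s (m : multiplicities s) : nat := (\sum_(k < s) m k)%N.

Section Traces.
Variable K : numFieldType.

Definition part_trace s (Psi : multiplicities s -> K) (F : nat -> K) : K :=
  \sum_(m : multiplicities s | is_partition m)
     Psi m * \prod_(k < s) F k.+1 ^+ m k.

Definition Psi_T s (m : multiplicities s) : K :=
  (2 * s)`!%:R
  * \prod_(k < s) (2 ^+ m k / ((m k)`!%:R * (2 * k.+1)`!%:R ^+ m k)).

Definition Psi_V s (m : multiplicities s) : K :=
  (2 * s)`!%:R / 2 * (-1) ^+ (part_length m).-1 * ((part_length m).-1)`!%:R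
  * \prod_(k < s) ((m k)`!%:R * (2 * k.+1)`!%:R ^+ m k)^-1.

End Traces.

(* Main.v *)
(* Write theta = z d/dz. The infinite product Phi_x(w) = \prod_n (1 - w x^n) is
   Euler's power series in w: its coefficients are chosen so that
   Phi_x(w) = (1 - w x) Phi_x(w x), and iterating this identity gives the product.
   The function theta Phi_x + Phi_x L_x, with L_x(w) = \sum_m w^m x^m / (1 - x^m),
   satisfies the same identity and vanishes at 0, hence is 0; thus theta Phi_x =
   - Phi_x L_x. Only power series are differentiated.
   As C(z; q) is a finite product of functions Phi_x(z^(+-r))^(+-1), theta log C is
   a combination of the L_x(z^(+-r)). At z = 1 its odd theta-derivatives are twice
   the quantities D_2k + B_2k / (4k), the divisor sums of G_2k being rewritten as
   Lambert series, and its even ones vanish. Leibniz' rule then gives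
     M_(2n+2) = \sum_k 'C(2n+1, 2k+1) M_(2n-2k) (2 D_(2k+2) + B_(2k+2) / (2k+2)),
   i.e. \sum_n M_2n X^n / (2n)! = exp (\sum_n 2 (D_2n + B_2n / (4n)) X^n / (2n)!).
   The two trace formulas are the expansions of exp and log over partitions. *)

Require Import Defs.
From mathcomp Require Import all_boot all_order all_algebra.
From mathcomp Require Import all_classical all_reals all_analysis.
From mathcomp Require Import ring lra.

Set Implicit Arguments.
Unset Strict Implicit.
Unset Printing Implicit Defensive.

Import Order.TTheory GRing.Theory Num.Theory.
Local Open Scope ring_scope.

(** * Exponential and logarithm over partitions *)

Section ExpCoefficients.
Variable F : numFieldType.

Lemma posnatr_neq0 n : (0 < n)%N -> n%:R != 0 :> F.
Proof. by rewrite pnatr_eq0 lt0n. Qed.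

Lemma fact_neq0 n : n`!%:R != 0 :> F.
Proof. by rewrite posnatr_neq0 ?fact_gt0. Qed.

(** Each factor is exp (c_k X) cut at degree N, and the cut is invisible in degrees at most N. The
    induction step is the binomial theorem divided by l!. *)
Lemma coef_prod_exp (A : comAlgType F) (I : Type) (r : seq I) (c : I -> A)
    (N l : nat) : (l <= N)%N ->
  (\prod_(k <- r) \poly_(j < N.+1) (j`!%:R^-1 *: c k ^+ j))`_l
  = l`!%:R^-1 *: (\sum_(k <- r) c k) ^+ l.
Proof.
elim: r l => [|k r IHr] l lN.
  rewrite !big_nil coef1 expr0n; case: l lN => [|l] _ /=.
    by rewrite invr1 scale1r.
  by rewrite scaler0.
rewrite !big_cons coefM addrC exprDn scaler_sumr.
apply: eq_bigr => -[i /= il] _; rewrite ltnS in il.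
rewrite coef_poly ltnS (leq_trans il lN) IHr; last first.
  by rewrite (leq_trans (leq_subr _ _)).
rewrite -scalerAl -scalerAr scalerA -scaler_nat scalerA mulrC [c k ^+ i * _]mulrC.
congr (_ *: _).
have h := fact_neq0 l; rewrite -(bin_fact il) !natrM !mulf_eq0 !negb_or in h *.
by case/and3P: h => h0 h1 h2; field; rewrite h0 h1 h2.
Qed.

(** Expanding the product of truncated exponentials over all choices of exponents and reading off
    degree l gives the multinomial theorem divided by l!. *)
Lemma multinomial (A : comAlgType F) (n N l : nat) (c : 'I_n -> A) : (l <= N)%N ->
  \sum_(m : {ffun 'I_n -> 'I_N.+1} | (\sum_(k < n) m k == l)%N)
     \prod_(k < n) ((m k)`!%:R^-1 *: c k ^+ m k)
  = l`!%:R^-1 *: (\sum_(k < n) c k) ^+ l.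
Proof.
move=> lN; rewrite -(coef_prod_exp _ _ lN).
under eq_bigr do rewrite poly_def.
rewrite bigA_distr_bigA coef_sum big_mkcond; apply: eq_bigr => /= m _.
have -> : \prod_(k < n) (((m k)`!%:R^-1 *: c k ^+ m k) *: 'X^(m k))
    = (\prod_(k < n) ((m k)`!%:R^-1 *: c k ^+ m k)) *: 'X^(\sum_(k < n) m k).
  by rewrite scaler_prod -expr_sum.
by rewrite coefZ coefXn eq_sym; case: eqP => _; rewrite ?mulr1 ?mulr0.
Qed.

Lemma part_length_le s (m : multiplicities s) :
  is_partition m -> (part_length m <= s)%N.
Proof.
move=> /eqP {2}<-; apply: leq_sum => k _.
by rewrite leq_pmull.
Qed.

Definition gen_poly (s : nat) (x : nat -> F) : {poly F} :=
  \sum_(k < s) x k.+1 *: 'X^(k.+1).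

Lemma coef_gen_poly s x i :
  (gen_poly s x)`_i = if (0 < i <= s)%N then x i else 0.
Proof.
rewrite coef_sum; case: ifP => [/andP[i0 le_is]|].
  case: i i0 le_is => // i _ le_is.
  rewrite (bigD1 (Ordinal le_is)) //= coefZ coefXn eqxx mulr1 big1 ?addr0 //.
  move=> j /negbTE; rewrite -val_eqE /= => ji.
  by rewrite coefZ coefXn eqSS eq_sym ji mulr0.
move=> his; rewrite big1 // => k _; rewrite coefZ coefXn.
case: eqP => [ik|]; last by rewrite mulr0.
by move: his; rewrite ik /= ltn_ord.
Qed.

(** [gen_poly s x] is divisible by ['X]. This discards the truncation errors of exp and log
    below. *)
Lemma coef_gen_poly_exp s x (p : {poly F}) n i : (i < n)%N ->
  (p * gen_poly s x ^+ n)`_i = 0.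
Proof.
move=> lt_in.
have -> : gen_poly s x = 'X * (\sum_(k < s) x k.+1 *: 'X^k).
  by rewrite mulr_sumr; apply: eq_bigr => k _; rewrite -scalerAr exprS.
by rewrite exprMn mulrCA coefXnM lt_in.
Qed.

(** Multiplicity vectors are grouped by length l. In the multinomial theorem with c_k = x_k X^k, the
    power of X records the number being partitioned, so partitions of s are the terms of degree
    s. *)
Lemma partition_sum_length s (phi : nat -> F) (x : nat -> F) :
  \sum_(m : multiplicities s | is_partition m)
    phi (part_length m) * \prod_(k < s) (x k.+1 ^+ m k / (m k)`!%:R)
  = \sum_(l < s.+1) phi l / l`!%:R * (gen_poly s x ^+ l)`_s.
Proof.
pose t (m : multiplicities s) : {poly F} :=
  \prod_(k < s) ((m k)`!%:R^-1 *: (x k.+1 *: 'X^(k.+1)) ^+ m k).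
have tE (m : multiplicities s) : t m
    = (\prod_(k < s) (x k.+1 ^+ m k / (m k)`!%:R))
        *: 'X^(\sum_(k < s) k.+1 * m k).
  rewrite /t expr_sum -scaler_prod; apply: eq_bigr => k _.
  by rewrite exprZn scalerA mulrC exprM.
have -> : \sum_(l < s.+1) phi l / l`!%:R * (gen_poly s x ^+ l)`_s
    = \sum_(l < s.+1) \sum_(m : multiplicities s | part_length m == l)
       phi l * (t m)`_s.
  apply: eq_bigr => -[l /= ls] _; rewrite ltnS in ls.
  by rewrite -mulr_sumr -coef_sum (multinomial _ ls) coefZ mulrA.
rewrite (exchange_big_dep predT) //= big_mkcond /=; apply: eq_bigr => m _.
under [RHS]eq_bigr do rewrite tE coefZ coefXn.
rewrite eq_sym -/(is_partition m); case: ifP => [mp|_]; last first.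
  by rewrite big1 // => i _; rewrite !mulr0.
rewrite (big_pred1 (Ordinal (part_length_le mp : part_length m < s.+1)%N)).
  by rewrite mulr1.
by move=> i; apply/eqP/eqP => [h|->//]; exact: val_inj.
Qed.

Section Recurrence.
(* With A = \sum a_n X^n and B = \sum_(n > 0) b_n X^n, this says that
   A' = B' A and A(0) = 1, i.e. A = exp B. *)
Variables a b : nat -> F.
Hypothesis a0 : a 0 = 1.
Hypothesis a_rec : forall n,
  n.+1%:R * a n.+1 = \sum_(k < n.+1) k.+1%:R * b k.+1 * a (n - k)%N.

(** The sum is the coefficient of X^s in the truncated exponential E of B. Since E' = B' E up to an
    error without terms of degree below s, the coefficients of E obey the recurrence of [a]. *)
Lemma exp_partition_sum s :
  \sum_(m : multiplicities s | is_partition m)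
     \prod_(k < s) (b k.+1 ^+ m k / (m k)`!%:R) = a s.
Proof.
have := partition_sum_length s (fun=> 1) b.
under eq_bigr do rewrite mul1r.
under [in RHS]eq_bigr do rewrite div1r -coefZ.
move=> ->; rewrite -coef_sum.
set B := gen_poly s b; set E := \sum_(l < _) _.
(* Differentiation shifts the exponential sum by one index, so exactly the top term B^s / s! is
   missing. *)
have E' : E^`() = B^`() * E - s`!%:R^-1 *: (B^`() * B ^+ s).
  rewrite /E big_ord_recr /= mulrDr -scalerAr addrK.
  rewrite -[in LHS](big_mkord predT (fun l => l`!%:R^-1 *: B ^+ l)).
  rewrite -(big_mkord predT (fun l => l`!%:R^-1 *: B ^+ l)).
  rewrite -[X in X + _]/(\sum_(0 <= l < s) _) -big_nat_recr //=.
  rewrite big_nat_recl // raddfD /= expr0 derivZ derivC scaler0 add0r.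
  rewrite raddf_sum mulr_sumr; apply: eq_bigr => i _.
  rewrite /= derivZ deriv_exp /= -scaler_nat scalerA -scalerAr factS natrM.
  by rewrite invfM mulrAC mulVf ?posnatr_neq0 // mul1r.
suff: forall i, (i <= s)%N -> E`_i = a i by apply.
elim/ltn_ind => -[|i] IH is_.
  rewrite a0 /E coef_sum big_ord_recl /= coefZ expr0 coef1 invr1 mulr1.
  rewrite big1 ?addr0 // => j _.
  by rewrite coefZ -[_ ^+ _]mul1r coef_gen_poly_exp ?mulr0.
apply/(mulfI (posnatr_neq0 (ltn0Sn i))); rewrite a_rec.
have := congr1 (fun p : {poly F} => p`_i) E'.
rewrite coef_deriv mulr_natl => ->.
rewrite coefB coefZ coef_gen_poly_exp // mulr0 subr0 coefM.
apply: eq_bigr => -[k /= ki] _; rewrite ltnS in ki.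
rewrite coef_deriv coef_gen_poly /= (leq_ltn_trans ki is_) mulr_natl.
by rewrite IH // ?ltnS ?leq_subr // (leq_trans (leq_subr _ _)) // ltnW.
Qed.

(** The weights (-1)^(l-1) (l-1)! divided by l! are the coefficients of log (1 + A). Its truncation
    L satisfies L' (1 + A) = A' below degree s, which is the recurrence solved for [b]. *)
Lemma log_partition_sum s : (0 < s)%N ->
  \sum_(m : multiplicities s | is_partition m)
     (-1) ^+ (part_length m).-1 * ((part_length m).-1)`!%:R
       * \prod_(k < s) (a k.+1 ^+ m k / (m k)`!%:R) = b s.
Proof.
move=> s0.
rewrite (partition_sum_length s (fun l => (-1) ^+ l.-1 * l.-1`!%:R) a).
set A := gen_poly s a.
rewrite big_ord_recl /= expr0 coef1 (gtn_eqF s0) mulr0 add0r.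
have -> : \sum_(i < s) (-1) ^+ (bump 0 i).-1 * ((bump 0 i).-1)`!%:R
    / (bump 0 i)`!%:R * (A ^+ bump 0 i)`_s
  = \sum_(i < s) (((-1) ^+ i / i.+1%:R) *: A ^+ i.+1)`_s.
  apply: eq_bigr => i _; rewrite coefZ /bump leq0n add1n /= factS natrM.
  have h1 := fact_neq0 i; have h2 := posnatr_neq0 (ltn0Sn i).
  by congr (_ * _); field; rewrite addrC natr1 h1 h2.
rewrite -coef_sum; set L := \sum_(i < _) _.
(* L' is A' times a finite geometric sum in - A, which telescopes against 1 + A. *)
have L' : L^`() * (1 + A) = A^`() * (1 - (- A) ^+ s).
  rewrite -{2}(expr1n _ s) subrXX opprK mulrA [A^`() * (1 + A)]mulrC.
  rewrite -mulrA mulrC; congr (_ * _).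
  rewrite /L raddf_sum mulr_sumr; apply: eq_bigr => i _ /=.
  rewrite derivZ deriv_exp /= expr1n mul1r -scaler_nat.
  rewrite scalerA mulfVK ?posnatr_neq0 // [in RHS]exprNn.
  rewrite -[(-1) ^+ i *: _]mul_polyC rmorphXn rmorphN rmorph1.
  by rewrite mulrCA.
suff: forall i, (i < s)%N -> L`_i.+1 = b i.+1.
  by case: s s0 @A @L L' => // s _ A L _; apply.
elim/ltn_ind => i IH is_.
have := congr1 (fun p : {poly F} => p`_i) L'.
rewrite /= mulrBr mulr1 exprNn mulrA coefB coef_gen_poly_exp // subr0 coefM.
have coefA j : (j <= s)%N -> (1 + A)`_j = a j.
  rewrite coefD coef1 coef_gen_poly; case: j => [|j] /= js; first by rewrite a0 addr0.
  by rewrite js add0r.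
rewrite coef_deriv coef_gen_poly /= is_ -mulr_natl a_rec.
(* The last term of each convolution carries the unknown coefficient with factor a_0 = 1; the other
   terms agree by induction. *)
rewrite [in LHS]big_ord_recr [in RHS]big_ord_recr /= subnn a0 coefA // a0 !mulr1.
rewrite coef_deriv => LR.
apply/(mulfI (posnatr_neq0 (ltn0Sn i))); rewrite [LHS]mulr_natl; move: LR.
set S1 := \sum_(j < i) _; set S2 := \sum_(j < i) _.
suff -> : S1 = S2 by move/addrI.
apply: eq_bigr => -[j /= ji] _; rewrite coef_deriv IH ?coefA ?mulr_natl //.
  by rewrite (leq_trans (leq_subr _ _)) // ltnW.
exact: ltn_trans is_.
Qed.

End Recurrence.
End ExpCoefficients.

Import numFieldNormedType.Exports.
Import ComplexField.Normc.
Local Open Scope classical_set_scope.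
Local Open Scope complex_scope.

(** * Power series over the complex numbers *)

Section ComplexModulus.
Variable R : realType.
Implicit Types z w : R[i].

Lemma normc_ge0 z : 0 <= normc z.
Proof. by case: z => a b; exact: sqrtr_ge0. Qed.

Lemma normr_normc z : `|z| = (normc z)%:C.
Proof. by case: z. Qed.

Lemma normc_eq0 z : (normc z == 0) = (z == 0).
Proof.
by apply/eqP/eqP => [/eq0_normc //|->]; exact: normc0.
Qed.

Lemma normcD z w : normc (z + w) <= normc z + normc w.
Proof. exact: le_normcD. Qed.

Lemma normc_opp z : normc (- z) = normc z.
Proof. exact: (@normcN R z). Qed.

Lemma normcX z n : normc (z ^+ n) = normc z ^+ n.
Proof. by elim: n => [|n IH]; rewrite ?normc1 // !exprS normcM IH. Qed.

Lemma normc_sum (I : Type) (r : seq I) (P : pred I) (F : I -> R[i]) :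
  normc (\sum_(i <- r | P i) F i) <= \sum_(i <- r | P i) normc (F i).
Proof.
elim/big_rec2: _ => [|i y x _ yx]; first by rewrite normc0.
by rewrite (le_trans (normcD _ _)) // lerD2l.
Qed.

Lemma normc_nat n : normc (n%:R : R[i]) = n%:R.
Proof.
have -> : (n%:R : R[i]) = (n%:R : R)%:C by rewrite rmorph_nat.
by rewrite /= expr0n /= addr0 sqrtr_sqr ger0_norm.
Qed.

Lemma normc_Re z : `|complex.Re z| <= normc z.
Proof.
case: z => a b /=; rewrite -sqrtr_sqr ler_wsqrtr // lerDl sqr_ge0 //.
Qed.

Lemma normc_Im z : `|complex.Im z| <= normc z.
Proof.
case: z => a b /=; rewrite -sqrtr_sqr ler_wsqrtr // lerDr sqr_ge0 //.
Qed.

Lemma normc_le_ReIm z : normc z <= `|complex.Re z| + `|complex.Im z|.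
Proof.
case: z => a b /=; rewrite -[X in _ <= X]ger0_norm ?addr_ge0 //.
rewrite -sqrtr_sqr ler_wsqrtr // sqrrD !real_normK ?num_real //.
by rewrite -addrA lerD2l lerDr mulrn_wge0 // mulr_ge0.
Qed.

Lemma complex_gt0P (e : R[i]) : 0 < e -> exists2 d : R, 0 < d & e = d%:C.
Proof.
case: e => a b; rewrite ltcE /= => /andP[/eqP -> a0].
by exists a.
Qed.

Local Notation C := (R[i] : numFieldType).

(** The norm on [R[i]] takes its values in [R[i]]; a positive complex number is real, so the epsilon
    may be taken in R. *)
Lemma cvg_normcP (T : Type) (F : set_system T) (FF : Filter F)
    (f : T -> C) (l : C) :
  f @ F --> l <-> forall e : R, 0 < e -> \forall x \near F, normc (f x - l) < e.
Proof.
split=> [/cvgrPdistC_lt fl e e0|fl].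
  have e0' : 0 < e%:C :> R[i] by rewrite ltcR.
  by apply: filterS (fl _ e0') => x; rewrite normr_normc ltcR.
apply/cvgrPdistC_lt => _ /complex_gt0P[d d0 ->].
by apply: filterS (fl _ d0) => x; rewrite normr_normc ltcR.
Qed.

Lemma cvg_ReIm (T : Type) (F : set_system T) (FF : Filter F)
    (f : T -> C) (a b : R) :
  (fun x => complex.Re (f x)) @ F --> a ->
  (fun x => complex.Im (f x)) @ F --> b -> f @ F --> (a +i* b : C).
Proof.
move=> /cvgrPdistC_lt fa /cvgrPdistC_lt fb; apply/cvg_normcP => e e0.
have e2 : 0 < e / 2 by rewrite divr_gt0.
move: (fa _ e2) (fb _ e2); apply: filterS2 => x ax bx.
rewrite (le_lt_trans (normc_le_ReIm _)) // [ltRHS]splitr.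
by move: ax bx; case: (f x) => u v /=; apply: ltrD.
Qed.

Lemma series_Re (u : nat -> C) n :
  complex.Re (series u n) = series (fun k => complex.Re (u k)) n.
Proof.
elim: n => [|n IH]; first by rewrite !seriesEord /= !big_ord0.
by rewrite !seriesSr -IH; case: (series u n) (u n) => [a b] [c d].
Qed.

Lemma series_Im (u : nat -> C) n :
  complex.Im (series u n) = series (fun k => complex.Im (u k)) n.
Proof.
elim: n => [|n IH]; first by rewrite !seriesEord /= !big_ord0.
by rewrite !seriesSr -IH; case: (series u n) (u n) => [a b] [c d].
Qed.

(** Real and imaginary parts are dominated by the same geometric series, so completeness of R
    suffices. *)
Lemma cvg_series_geometric_bound (u : nat -> C) (M r : R) :
  0 <= r < 1 -> (forall n, normc (u n) <= M * r ^+ n) -> cvgn (series u).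
Proof.
move=> /andP[r0 r1] uM.
have cv (v : nat -> R) : (forall n, `|v n| <= M * r ^+ n) -> cvgn (series v).
  move=> vM; apply: normed_cvg.
  apply: (@series_le_cvg _ _ (geometric M r)) => //.
  - by move=> n; exact: normr_ge0.
  - by move=> n; apply: le_trans (normr_ge0 _) (vM n).
  - by apply: is_cvg_geometric_series; rewrite ger0_norm.
have cRe := cv _ (fun n => le_trans (normc_Re _) (uM n)).
have cIm := cv _ (fun n => le_trans (normc_Im _) (uM n)).
apply/cvg_ex; eexists; apply: cvg_ReIm.
  by under eq_fun do rewrite series_Re; exact: cRe.
by under eq_fun do rewrite series_Im; exact: cIm.
Qed.

Lemma normc_lim_le (u : nat -> C) (l : C) (M : R) :
  u @ \oo --> l -> (forall n, normc (u n) <= M) -> normc l <= M.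
Proof.
move=> /cvg_normcP ul uM; apply/ler_addgt0Pr => e e0.
have [N _ /(_ N (leqnn N)) /= h] := ul e e0.
rewrite -[l](subKr (u N)) (le_trans (normcD _ _)) // lerD //.
by rewrite normc_opp ltW.
Qed.

Lemma sum_geometric_le (M r : R) n : 0 <= M -> 0 <= r < 1 ->
  \sum_(k < n) M * r ^+ k <= M / (1 - r).
Proof.
move=> M0 /andP[r0 r1].
rewrite -(@ler_pM2r _ (1 - r)) ?subr_gt0 // mulfVK ?subr_eq0 ?gt_eqF //.
rewrite -mulr_sumr -mulrA ler_piMr //.
rewrite mulrC -opprB mulNr -subrX1 opprB gerBl exprn_ge0 //.
Qed.

Lemma nat_exp_le (s s' : R) : 0 <= s -> s < s' ->
  exists2 M, 0 <= M & forall n, n%:R * s ^+ n <= M * s' ^+ n.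
Proof.
move=> s0 ss'; have s'0 : 0 < s' by apply: le_lt_trans ss'.
(* This constant turns the claim into (s' - s) n s^n <= s'^(n+1), which passes from n to n + 1. *)
exists (s' / (s' - s)); first by rewrite divr_ge0 ?subr_ge0 // ltW.
have d0 : 0 < s' - s by rewrite subr_gt0.
elim=> [|n IH]; first by rewrite mul0r mulr_ge0 ?exprn_ge0 ?divr_ge0 // ltW.
rewrite -(@ler_pM2l _ (s' - s)) // in IH; rewrite -(@ler_pM2l _ (s' - s)) //.
have e k : (s' - s) * (s' / (s' - s) * s' ^+ k) = s' ^+ k.+1.
  by rewrite mulrA mulrCA mulfV ?gt_eqF // mulr1 exprS.
rewrite e in IH; rewrite e.
have sn : s ^+ n.+1 <= s' ^+ n.+1 by rewrite lerXn2r ?nnegrE // ltW.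
rewrite [s' ^+ n.+2]exprS -natr1 exprS.
have h1 : s * ((s' - s) * (n%:R * s ^+ n)) <= s * s' ^+ n.+1 by rewrite ler_wpM2l.
have h2 : (s' - s) * s ^+ n.+1 <= (s' - s) * s' ^+ n.+1.
  by rewrite ler_wpM2l // ltW.
rewrite exprS in h2; lra.
Qed.

Lemma mid_growth (a rho : R) : 0 <= a -> 0 <= rho -> a * rho < 1 ->
  exists b s : R, [/\ a < b, rho < s & b * s < 1].
Proof.
move=> a0 r0 ar.
(* With this e < 1, the increase e (a + rho + e) of the product stays below e (2 + a + rho) = 1 - a
   rho. *)
pose e := (1 - a * rho) / (2 + a + rho).
have d0 : 0 < 2 + a + rho by lra.
have e0 : 0 < e by rewrite divr_gt0 // subr_gt0.
have e1 : e < 1 by rewrite ltr_pdivrMr // mul1r; nra.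
have ee : e * (2 + a + rho) = 1 - a * rho by rewrite mulfVK // gt_eqF.
by exists (a + e), (rho + e); split; nra.
Qed.

(* The coefficients a_n grow at most like rho^n, up to an arbitrarily small
   loss in rho; the loss is what makes the notion stable under a_n |-> n a_n. *)
Definition growth (a : nat -> C) (rho : R) : Prop :=
  forall s, rho < s -> exists M, forall n, normc (a n) <= M * s ^+ n.

Definition pser (a : nat -> C) (w : C) : C := limn (series (fun n => a n * w ^+ n)).

Definition cvg_pser (a : nat -> C) (w : C) : Prop :=
  series (fun n => a n * w ^+ n) @ \oo --> pser a w.

Lemma cvg_pserS a (w : C) : cvg_pser a w ->
  (fun N => series (fun n => a n * w ^+ n) N.+1) @ \oo --> pser a w.
Proof. by move=> h; rewrite (cvg_shiftS (series (fun n => a n * w ^+ n))). Qed.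

(** There is room for some s > rho with |w| s < 1, and the terms are then dominated by a geometric
    series of ratio |w| s. *)
Lemma growth_cvg a rho (w : C) : 0 <= rho -> growth a rho -> normc w * rho < 1 ->
  cvg_pser a w.
Proof.
move=> r0 ga wr.
have [b [s [wb rs bs]]] := mid_growth (normc_ge0 w) r0 wr.
have [M aM] := ga _ rs.
have s0 : 0 <= s by apply: le_trans r0 (ltW rs).
apply: (@cvg_series_geometric_bound _ M (normc w * s)).
  rewrite mulr_ge0 ?normc_ge0 //= (le_lt_trans _ bs) // ler_wpM2r // ltW //.
move=> n; rewrite normcM normcX exprMn [normc w ^+ n * _]mulrC mulrA.
by rewrite ler_wpM2r // exprn_ge0 // normc_ge0.
Qed.

Lemma growth_nat a rho : 0 <= rho -> growth a rho ->
  growth (fun n => n%:R * a n) rho.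
Proof.
move=> r0 ga s rs; pose s' := (rho + s) / 2.
have rs' : rho < s' by rewrite /s'; lra.
have s's : s' < s by rewrite /s'; lra.
have [M1 aM] := ga _ rs'.
have s'0 : 0 <= s' by rewrite (le_trans r0) // ltW.
have [M2 M20 nM] := nat_exp_le s'0 s's.
have M10 : 0 <= M1 by have := aM 0%N; rewrite expr0 mulr1; apply/le_trans/normc_ge0.
exists (M1 * M2) => n; rewrite normcM normc_nat.
apply: le_trans (_ : n%:R * (M1 * s' ^+ n) <= _); first by rewrite ler_wpM2l.
by rewrite mulrCA -mulrA ler_wpM2l.
Qed.

(* The factor b ^+ 2 on the left stands for b ^+ (n - 2) on the right, which is
   wrong under truncated subtraction. *)
Lemma taylor2_exp (w h : C) (b : R) n : normc w + normc h <= b ->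
  b ^+ 2 * normc ((w + h) ^+ n - w ^+ n - h * (n%:R * w ^+ n.-1))
   <= n%:R ^+ 2 * b ^+ n * normc h ^+ 2.
Proof.
move=> wb; have b0 : 0 <= b by apply: le_trans wb; rewrite addr_ge0 ?normc_ge0.
have whb : normc (w + h) <= b by apply: le_trans (normcD _ _) wb.
have wb' : normc w <= b by apply: le_trans wb; rewrite lerDl normc_ge0.
elim: n => [|n IH].
  by rewrite !expr0 mul0r mulr0 !subr0 subrr normc0 mulr0 expr0n !mul0r.
have -> : (w + h) ^+ n.+1 - w ^+ n.+1 - h * (n.+1%:R * w ^+ n.+1.-1)
   = (w + h) * ((w + h) ^+ n - w ^+ n - h * (n%:R * w ^+ n.-1))
     + n%:R * h ^+ 2 * w ^+ n.-1.
  by case: n {IH} => [|n] /=; rewrite ?exprS ?expr0 -?natr1; ring.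
apply: le_trans (_ : b * (n%:R ^+ 2 * b ^+ n * normc h ^+ 2)
                     + n%:R * b ^+ n.+1 * normc h ^+ 2 <= _).
  apply: le_trans (ler_wpM2l _ (normcD _ _)) _; first by rewrite exprn_ge0.
  rewrite mulrDr lerD //.
    rewrite normcM mulrCA.
    by rewrite ler_pM // ?normc_ge0 // mulr_ge0 ?exprn_ge0 ?normc_ge0.
  case: n {IH} => [|n]; first by rewrite !mul0r normc0 mulr0.
  rewrite !normcM !normcX normc_nat /=.
  have -> : b ^+ 2 * (n.+1%:R * normc h ^+ 2 * normc w ^+ n)
    = (n.+1%:R * normc h ^+ 2 * b ^+ 2) * normc w ^+ n by ring.
  have -> : n.+1%:R * b ^+ n.+2 * normc h ^+ 2
    = (n.+1%:R * normc h ^+ 2 * b ^+ 2) * b ^+ n by rewrite !exprS; ring.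
  rewrite ler_wpM2l ?mulr_ge0 ?exprn_ge0 ?normc_ge0 //.
  by rewrite lerXn2r ?nnegrE ?normc_ge0.
rewrite -subr_ge0 (_ : _ - _ = n.+1%:R * b ^+ n.+1 * normc h ^+ 2).
  by rewrite !mulr_ge0 ?exprn_ge0 ?normc_ge0.
by rewrite !exprS !expr0 -natr1; ring.
Qed.

(** The difference quotient is off by at most M |h|, which is below e once |h| < e / (|M| + 1). *)
Lemma is_derive_quadratic (f : C -> C) (w d : C) (b M : R) : 0 < b ->
  (forall h : C, normc h <= b -> normc (f (w + h) - f w - h * d) <= M * normc h ^+ 2) ->
  is_derive w (1 : C) f d.
Proof.
move=> b0 fM.
suff cd : (fun h : C => h^-1 *: ((f \o shift w) (h *: 1) - f w)) @ 0^' --> d.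
  by apply: DeriveDef; [exact: cvgP cd|exact: cvg_lim cd].
apply/cvg_normcP => e e0.
have M1 : 0 < `|M| + 1 by rewrite ltr_pwDr.
have d0 : 0 < Num.min b (e / (`|M| + 1)) by rewrite lt_min b0 divr_gt0.
have d0' : 0 < (Num.min b (e / (`|M| + 1)))%:C :> R[i] by rewrite ltcR.
near=> h.
have h0 : h != 0 by near: h; exact: nbhs_dnbhs_neq.
have : `|h| < (Num.min b (e / (`|M| + 1)))%:C by near: h; exact: dnbhs0_lt.
rewrite normr_normc ltcR lt_min => /andP[hb he].
rewrite /= [h *: 1]mulr1 [h + w]addrC.
have nh : 0 < normc h by rewrite lt_neqAle normc_ge0 eq_sym normc_eq0 h0.
have -> : h^-1 *: (f (w + h) - f w) - d = h^-1 * (f (w + h) - f w - h * d).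
  by rewrite [in RHS]mulrBr mulrA mulVf // mul1r.
rewrite normcM normcV mulrC ltr_pdivrMr //.
apply: le_lt_trans (fM _ (ltW hb)) _; rewrite expr2 mulrA ltr_pM2r //.
rewrite ltr_pdivlMr // in he; apply: le_lt_trans he.
by rewrite mulrC ler_pM2l //; apply: le_trans (ler_norm M) _; rewrite lerDl.
Unshelve. all: by end_near. Qed.

Lemma growth_shift a rho : 0 <= rho -> growth a rho -> growth (fun n => a n.+1) rho.
Proof.
move=> r0 ga s rs; have [M aM] := ga _ rs.
by exists (M * s) => n; rewrite -mulrA -exprS.
Qed.

Definition dpser (a : nat -> C) (n : nat) : C := n.+1%:R * a n.+1.

Lemma growth_dpser a rho : 0 <= rho -> growth a rho -> growth (dpser a) rho.
Proof. by move=> r0 /(growth_nat r0) /(growth_shift r0). Qed.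

(** The second-order Taylor remainders of the terms are summed. The growth of n^2 a_n bounds the
    partial sums by a geometric series times |h|^2, and the bound passes to the limit. *)
Lemma is_derive_pser a rho (w : C) : 0 <= rho -> growth a rho -> normc w * rho < 1 ->
  is_derive w (1 : C) (pser a) (pser (dpser a) w).
Proof.
move=> r0 ga wr.
have [b [s [wb rs bs]]] := mid_growth (normc_ge0 w) r0 wr.
have b0 : 0 < b by apply: le_lt_trans wb; exact: normc_ge0.
have [M aM] := growth_nat r0 (growth_nat r0 ga) rs.
have s0 : 0 <= s by apply: le_trans r0 (ltW rs).
have bs0 : 0 <= b * s by rewrite mulr_ge0 // ltW.
have M0 : 0 <= M by have := aM 0%N; rewrite expr0 mulr1; apply/le_trans/normc_ge0.
(* The radius keeps |w| + |h| <= b; the constant is the sum of M (b s)^k, divided by the b^2 of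
   [taylor2_exp]. *)
apply: (@is_derive_quadratic _ _ _ (b - normc w) (M / (1 - b * s) / b ^+ 2)).
  by rewrite subr_gt0.
move=> h hb; have whb : normc w + normc h <= b by lra.
have whr : normc (w + h) * rho < 1.
  apply: le_lt_trans bs; apply: ler_pM => //; rewrite ?normc_ge0 //; last exact: ltW.
  exact: le_trans (normcD _ _) _.
have c1 : cvg_pser a (w + h) by apply: growth_cvg whr.
have c2 : cvg_pser a w by apply: growth_cvg wr.
have c3 : cvg_pser (dpser a) w by apply: growth_cvg wr => //; exact: growth_dpser.
(* [dpser] lowers the index by one, so N of its terms match N + 1 terms of [a]. *)
have cl : (fun N => series (fun n => a n * (w + h) ^+ n) N.+1
    - series (fun n => a n * w ^+ n) N.+1
    - h * series (fun n => dpser a n * w ^+ n) N) @ \oo -->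
    pser a (w + h) - pser a w - h * pser (dpser a) w.
  exact: cvgB (cvgB (cvg_pserS c1) (cvg_pserS c2)) (cvgM (cvg_cst h) c3).
apply: normc_lim_le cl _.
move=> n /=.
rewrite [X in normc X](_ : _ = \sum_(k < n.+1)
   a k * ((w + h) ^+ k - w ^+ k - h * (k%:R * w ^+ k.-1))); last first.
  rewrite !seriesEord /= -sumrB mulr_sumr big_ord_recl [in RHS]big_ord_recl /=.
  rewrite !expr0 mul0r mulr0 !subrr !mulr0 !add0r -sumrB.
  by apply: eq_bigr => k _; rewrite /dpser /bump leq0n add1n /=; ring.
apply: le_trans (normc_sum _ _ _) _.
apply: le_trans (_ : \sum_(k < n.+1) (M * (b * s) ^+ k) / b ^+ 2 * normc h ^+ 2 <= _).
  apply: ler_sum => k _.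
  have ak := aM k; rewrite !normcM normc_nat in ak.
  rewrite mulrAC ler_pdivlMr ?exprn_gt0 // normcM -mulrA [_ * b ^+ 2]mulrC.
  apply: le_trans (ler_wpM2l (normc_ge0 _) (taylor2_exp k whb)) _.
  rewrite [leLHS](_ : _ = k%:R * (k%:R * normc (a k)) * (b ^+ k * normc h ^+ 2)).
    have -> : M * (b * s) ^+ k * normc h ^+ 2 = M * s ^+ k * (b ^+ k * normc h ^+ 2).
      by rewrite exprMn; ring.
    rewrite ler_wpM2r //.
    by rewrite mulr_ge0 ?exprn_ge0 ?normc_ge0 // ltW.
  by ring.
rewrite -mulr_suml -mulr_suml ler_wpM2r ?exprn_ge0 ?normc_ge0 //.
rewrite ler_wpM2r ?invr_ge0 ?exprn_ge0 ?(ltW b0) //.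
by apply: sum_geometric_le => //; rewrite bs0.
Qed.

Lemma pser_dpser a rho (w : C) : 0 <= rho -> growth a rho -> normc w * rho < 1 ->
  w * pser (dpser a) w = pser (fun n => n%:R * a n) w.
Proof.
move=> r0 ga wr.
have c1 : cvg_pser (dpser a) w by apply: growth_cvg wr => //; exact: growth_dpser.
have c2 : cvg_pser (fun n => n%:R * a n) w.
  by apply: growth_cvg wr => //; exact: growth_nat.
have c3 : (fun N => w * series (fun n => dpser a n * w ^+ n) N) @ \oo
    --> w * pser (dpser a) w by exact: cvgM (cvg_cst w) c1.
suff e : (fun N => w * series (fun n => dpser a n * w ^+ n) N)
    = (fun N => series (fun n => n%:R * a n * w ^+ n) N.+1).
  by rewrite e in c3; apply: cvg_unique c3 (cvg_pserS c2).
apply/funext => n /=; rewrite !seriesEord /= big_ord_recl /= !mul0r add0r mulr_sumr.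
by apply: eq_bigr => k _; rewrite /dpser /bump leq0n add1n exprS; ring.
Qed.

Lemma pser0 a : pser a 0 = a 0%N.
Proof.
apply: cvg_lim => //; rewrite -(cvg_shiftS (series (fun n => a n * 0 ^+ n))).
rewrite (_ : [sequence _]_n = fun=> a 0%N); first exact: cvg_cst.
apply/funext => n /=; rewrite seriesEord /= big_ord_recl /= mulr1 big1 ?addr0 //.
by move=> k _; rewrite exprS mul0r mulr0.
Qed.

(** A power series is continuous at 0, and w x^n tends to 0 for every w, inside the disc of
    convergence or not. *)
Lemma cvg_pser_at0 a rho (w x : C) : 0 <= rho -> growth a rho -> normc x < 1 ->
  (fun n => pser a (w * x ^+ n)) @ \oo --> a 0%N.
Proof.
move=> r0 ga x1.
have d0 : is_derive (0 : C) (1 : C) (pser a) (pser (dpser a) 0).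
  by apply: is_derive_pser ga _; rewrite ?normc0 ?mul0r.
have : {for (0 : C), continuous (pser a)}.
  by apply: differentiable_continuous; apply/derivable1_diffP; exact: ex_derive.
rewrite -[X in _ --> X]pser0 => c0.
suff cx : (fun n => w * x ^+ n : C) @ \oo --> (0 : C) by exact: cvg_comp cx c0.
apply/cvg_normcP => e e0.
have e1 : 0 < e / (normc w + 1) by rewrite divr_gt0 // ltr_wpDl ?normc_ge0.
have x1' : `|normc x| < 1 by rewrite ger0_norm ?normc_ge0.
move/cvgrPdistC_lt: (cvg_expr x1') => /(_ _ e1); apply: filterS => n.
rewrite !subr0 ger0_norm ?exprn_ge0 ?normc_ge0 // normcM normcX.
have w0 := normc_ge0 w; have x0 : 0 <= normc x ^+ n by rewrite exprn_ge0 ?normc_ge0.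
rewrite ltr_pdivlMr; last by lra.
by nra.
Qed.

End ComplexModulus.

(** * The q-Pochhammer symbol *)

Section QPochhammer.
Variable R : realType.
Local Notation C := (R[i] : numFieldType).
Implicit Types (a b c : nat -> C) (w v z : C).

(** This reduces each functional equation below to an identity between coefficients. With v = w x
    and k a multiple of v, multiplication by k is the index shift in the last series. *)
Lemma pser_split a b c w v k e : cvg_pser a w -> cvg_pser b v -> cvg_pser c v ->
  a 0%N = e + b 0%N ->
  (forall n, a n.+1 * w ^+ n.+1 = b n.+1 * v ^+ n.+1 + k * (c n * v ^+ n)) ->
  pser a w = e + pser b v + k * pser c v.
Proof.
move=> ca cb cc a0 aS.
have cr : (fun N => e + series (fun n => b n * v ^+ n) N.+1
     + k * series (fun n => c n * v ^+ n) N) @ \oo --> e + pser b v + k * pser c v.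
  exact: cvgD (cvgD (cvg_cst e) (cvg_pserS cb)) (cvgM (cvg_cst k) cc).
suff E : (fun N => series (fun n => a n * w ^+ n) N.+1)
   = (fun N => e + series (fun n => b n * v ^+ n) N.+1
     + k * series (fun n => c n * v ^+ n) N).
  by have := cvg_pserS ca; rewrite E => h; apply: cvg_unique h cr.
apply/funext => N; rewrite !seriesEord /= big_ord_recl [in RHS]big_ord_recl /=.
rewrite !expr0 !mulr1 a0 -!addrA; congr (_ + (_ + _)).
by rewrite mulr_sumr -big_split; apply: eq_bigr => i _; rewrite /bump leq0n add1n aS.
Qed.

Lemma cvg_seriesD a b w : cvg_pser a w -> cvg_pser b w ->
  series (fun n => (a n + b n) * w ^+ n) @ \oo --> pser a w + pser b w.
Proof.
move=> ca cb.
suff -> : series (fun n => (a n + b n) * w ^+ n)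
  = series (fun n => a n * w ^+ n) + series (fun n => b n * w ^+ n).
  exact: cvgD ca cb.
apply/funext => N; rewrite /GRing.add /= !seriesEord /= -big_split /=.
by apply: eq_bigr => i _; rewrite mulrDl.
Qed.

Lemma pserD a b w : cvg_pser a w -> cvg_pser b w ->
  pser (fun n => a n + b n) w = pser a w + pser b w.
Proof.
move=> ca cb; have h := cvg_seriesD ca cb.
by rewrite /pser (cvg_lim _ h).
Qed.

Lemma cvg_pserD a b w : cvg_pser a w -> cvg_pser b w ->
  cvg_pser (fun n => a n + b n) w.
Proof. by move=> ca cb; rewrite /cvg_pser (pserD ca cb); exact: cvg_seriesD. Qed.

Lemma growth_cst (u : C) : growth (fun=> u) 1.
Proof.
move=> s s1; exists (normc u) => n.
by rewrite ler_peMr ?normc_ge0 // exprn_ege1 // ltW.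
Qed.

Lemma pser_geometric v : normc v < 1 -> pser (fun=> 1) v = (1 - v)^-1.
Proof.
move=> v1.
have v1' : normc v * 1 < 1 by rewrite mulr1.
have c0 : cvg_pser (fun=> 0) v by apply: growth_cvg v1' => //; exact: growth_cst.
have c1 : cvg_pser (fun=> 1) v by apply: growth_cvg v1' => //; exact: growth_cst.
have z0 : pser (fun=> 0) v = 0.
  have := @pserD (fun=> 0) (fun=> 0) v c0 c0; rewrite addr0 => e.
  by apply: (addrI (pser (fun=> 0) v)); rewrite -e addr0.
have := @pser_split (fun=> 1) (fun=> 0) (fun=> 1) v v v 1 c1 c0 c1.
rewrite z0 !addr0 => /(_ erefl) h.
have {}h : pser (fun=> 1) v = 1 + v * pser (fun=> 1) v.
  by apply: h => n; rewrite mul0r add0r !mul1r exprS.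
have v0 : 1 - v != 0.
  by rewrite subr_eq0; apply: contraTneq v1 => <-; rewrite normc1 ltxx.
by apply: (mulfI v0); rewrite mulfV // mulrBl mul1r {1}h addrK.
Qed.

Lemma growth_ratio a (s : R) N : 0 < s ->
  (forall n, (N <= n)%N -> normc (a n.+1) <= s * normc (a n)) ->
  exists M, forall n, normc (a n) <= M * s ^+ n.
Proof.
(* The sum dominates each of the first N + 1 quotients |a_k| / s^k; from N on the ratio hypothesis
   takes over. *)
move=> s0 aN; exists (\sum_(k < N.+1) normc (a k) / s ^+ k).
have small n : (n <= N)%N ->
    normc (a n) <= (\sum_(k < N.+1) normc (a k) / s ^+ k) * s ^+ n.
  move=> nN; rewrite -ler_pdivrMr ?exprn_gt0 //.
  rewrite (bigD1 (Ordinal (nN : n < N.+1)%N)) //= lerDl sumr_ge0 // => k _.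
  by rewrite divr_ge0 ?normc_ge0 // exprn_ge0 // ltW.
elim=> [|n IH]; first exact: small.
have [nN|Nn] := leqP n.+1 N; first exact: small.
rewrite (le_trans (aN _ Nn)) // exprS mulrCA.
by rewrite ler_wpM2l // ltW.
Qed.

Variable x : C.
Hypothesis x1 : normc x < 1.

Let x0 : 0 <= normc x := normc_ge0 x.

(** In closed form, (-1)^n x^(n(n+1)/2) / ((1 - x) ... (1 - x^n)). *)
Fixpoint euler_coef (n : nat) : C :=
  if n is m.+1 then - (x ^+ n / (1 - x ^+ n)) * euler_coef m else 1.

(* Division by zero gives lambert_coef 0 = 0, so the index 0 may be kept in sums. *)
Definition lambert_coef (n : nat) : C := x ^+ n / (1 - x ^+ n).

(** In the usual notation this is (w x; x)_infinity: the product starts at n = 1. *)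
Definition qpoch : C -> C := pser euler_coef.

Definition lambert (i : nat) : C -> C := pser (fun n => n%:R ^+ i * lambert_coef n).

Lemma normc_expn_lt1 n : normc (x ^+ n.+1) < 1.
Proof. by rewrite normcX exprn_ilt1. Qed.

Lemma one_sub_neq0 v : normc v < 1 -> 1 - v != 0.
Proof.
by move=> v1; rewrite subr_eq0; apply: contraTneq v1 => <-; rewrite normc1 ltxx.
Qed.

Lemma one_sub_normc_le n : 1 - normc x <= normc (1 - x ^+ n.+1).
Proof.
apply: le_trans (_ : 1 - normc x ^+ n.+1 <= _).
  by rewrite lerD2l lerN2 exprS ler_piMr // exprn_ile1 // ltW.
rewrite lerBlDr -[X in X <= _](normc1 R) -normcX.
by rewrite -{1}[1](subrK (x ^+ n.+1)) normcD.
Qed.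

Lemma lambert_coef_le n : normc (lambert_coef n) <= (1 - normc x)^-1 * normc x ^+ n.
Proof.
have x1' : 0 < 1 - normc x by rewrite subr_gt0.
case: n => [|n].
  by rewrite /lambert_coef expr0 subrr invr0 mulr0 normc0 mulr1 invr_ge0 ltW.
rewrite normcM normcV normcX mulrC ler_wpM2r ?exprn_ge0 //.
rewrite lef_pV2 ?posrE //; last first.
  by rewrite lt_neqAle normc_ge0 eq_sym normc_eq0 one_sub_neq0 // normc_expn_lt1.
exact: one_sub_normc_le.
Qed.

Lemma growth_lambert : growth lambert_coef (normc x).
Proof.
move=> s xs; exists (1 - normc x)^-1 => n.
apply: le_trans (lambert_coef_le n) _.
rewrite ler_wpM2l ?invr_ge0 ?subr_ge0 ?(ltW x1) //.
by rewrite lerXn2r ?nnegrE // ?(ltW xs) // (le_trans x0) // ltW.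
Qed.

Lemma growth_lambert_nat i : growth (fun n => n%:R ^+ i * lambert_coef n) (normc x).
Proof.
elim: i => [|i IH].
  by move=> s xs; have [M h] := growth_lambert xs; exists M => n; rewrite expr0 mul1r.
move=> s xs; have [M h] := growth_nat x0 IH xs; exists M => n.
by rewrite exprS -mulrA.
Qed.

(** Consecutive coefficients have ratios tending to 0. The rate |x| is chosen to give the same disc
    |w x| < 1 as for [lambert]. *)
Lemma growth_euler : growth euler_coef (normc x).
Proof.
move=> s xs; have s0 : 0 < s by apply: le_lt_trans xs.
have x1' : 0 < 1 - normc x by rewrite subr_gt0.
have e0 : 0 < s * (1 - normc x) by rewrite mulr_gt0.
have x1n : `|normc x| < 1 by rewrite ger0_norm.
have /cvgrPdistC_lt/(_ _ e0)[N _ xN] := cvg_expr x1n.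
apply: (@growth_ratio _ _ N) => // n Nn.
rewrite /= normcM normc_opp ler_wpM2r ?normc_ge0 //.
apply: le_trans (lambert_coef_le n.+1) _.
rewrite mulrC ler_pdivrMr //.
have := xN n.+1 (leqW Nn); rewrite /= subr0 ger0_norm ?exprn_ge0 //.
exact: ltW.
Qed.

Section Disc.
Variable w : C.
Hypothesis wx1 : normc (w * x) < 1.

Lemma qdisc n : normc (w * x ^+ n * x) < 1.
Proof.
rewrite mulrAC normcM normcX; apply: le_lt_trans wx1.
by rewrite ler_piMr ?normc_ge0 // exprn_ile1 // ltW.
Qed.

Lemma qdisc_growth : normc w * normc x < 1.
Proof. by rewrite -normcM. Qed.

Lemma qdisc_growth1 : normc (w * x) * normc x < 1.
Proof. by have := qdisc 1; rewrite expr1 normcM. Qed.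

Lemma qpoch_funeq : qpoch w = (1 - w * x) * qpoch (w * x).
Proof.
rewrite /qpoch (@pser_split euler_coef euler_coef euler_coef w (w * x) (- (w * x)) 0).
- by rewrite add0r mulNr mulrBl mul1r.
- exact: growth_cvg growth_euler qdisc_growth.
- exact: growth_cvg growth_euler qdisc_growth1.
- exact: growth_cvg growth_euler qdisc_growth1.
- by rewrite add0r.
move=> n; have h := one_sub_neq0 (normc_expn_lt1 n).
rewrite /= [(w * x) ^+ n.+1]exprMn [(w * x) ^+ n]exprMn.
by move: h; rewrite !exprS => h; field.
Qed.

(** Formally this is theta applied to [qpoch_funeq], the last term coming from theta (1 - w x) = - w
    x. It is checked on coefficients, where n + 1 splits as n and 1. *)
Lemma theta_qpoch_funeq :
  pser (fun n => n%:R * euler_coef n) w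
  = (1 - w * x) * pser (fun n => n%:R * euler_coef n) (w * x) - w * x * qpoch (w * x).
Proof.
have g := growth_nat x0 growth_euler.
have c1 := growth_cvg x0 g qdisc_growth1.
have c2 := growth_cvg x0 growth_euler qdisc_growth1.
rewrite (@pser_split _ (fun n => n%:R * euler_coef n)
  (fun n => n%:R * euler_coef n + euler_coef n) w (w * x) (- (w * x)) 0).
- by rewrite (pserD c1 c2) /qpoch; ring.
- exact: growth_cvg g qdisc_growth.
- exact: c1.
- exact: cvg_pserD c1 c2.
- by rewrite add0r.
move=> n; have h := one_sub_neq0 (normc_expn_lt1 n).
rewrite /= [(w * x) ^+ n.+1]exprMn [(w * x) ^+ n]exprMn -natr1.
by move: h; rewrite !exprS => h; field.
Qed.

(** The coefficients satisfy l_n = l_n x^n + x^n, and the last part sums to a geometric series. *)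
Lemma lambert_funeq :
  lambert 0 w = lambert 0 (w * x) + w * x / (1 - w * x).
Proof.
have g := growth_lambert_nat 0.
rewrite /lambert (@pser_split _ (fun n => n%:R ^+ 0 * lambert_coef n)
  (fun=> 1) w (w * x) (w * x) 0).
- by rewrite add0r pser_geometric.
- exact: growth_cvg g qdisc_growth.
- exact: growth_cvg g qdisc_growth1.
- by apply: growth_cvg (growth_cst 1) _ => //; rewrite mulr1.
- by rewrite add0r.
move=> n; have h := one_sub_neq0 (normc_expn_lt1 n).
rewrite /lambert_coef !expr0 !mul1r [(w * x) ^+ n.+1]exprMn [(w * x) ^+ n]exprMn.
by move: h; rewrite !exprS => h; field.
Qed.

End Disc.

Lemma funeq_iter (H : C -> C) w N :
  (forall v, normc (v * x) < 1 -> H v = (1 - v * x) * H (v * x)) ->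
  normc (w * x) < 1 ->
  H w = \prod_(1 <= n < N.+1) (1 - w * x ^+ n) * H (w * x ^+ N).
Proof.
move=> HE wx1; elim: N => [|N IH].
  by rewrite big_geq // mul1r expr0 mulr1.
rewrite IH HE; last exact: qdisc.
by rewrite [in RHS]big_nat_recr //= -!mulrA exprSr.
Qed.

(** Iterating the functional equation moves the argument towards 0, where the value is within 1 of
    [euler_coef 0] = 1; the finitely many factors split off are nonzero. *)
Lemma qpoch_neq0 w : normc (w * x) < 1 -> qpoch w != 0.
Proof.
move=> wx1.
have /cvg_normcP/(_ 1 ltr01)[N _ /(_ N (leqnn N)) /= h] :=
  @cvg_pser_at0 _ euler_coef _ w _ x0 growth_euler x1.
rewrite (@funeq_iter qpoch _ N) //; last by move=> v; exact: qpoch_funeq.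
rewrite mulf_neq0 //; last first.
  by apply: contraTneq h; rewrite /qpoch => ->; rewrite sub0r normc_opp normc1 ltxx.
rewrite big_add1 big_mkord; apply/prodf_neq0 => n _.
by apply: one_sub_neq0; rewrite exprSr mulrA qdisc.
Qed.

(** The partial product is the quotient of [qpoch w] by [qpoch (w * x ^+ N)], whose denominator
    tends to 1. *)
Lemma cvg_qpoch w : normc (w * x) < 1 ->
  (fun N => \prod_(1 <= n < N.+1) (1 - w * x ^+ n)) @ \oo --> qpoch w.
Proof.
move=> wx1.
have h : (fun N => qpoch (w * x ^+ N)) @ \oo --> euler_coef 0.
  exact: cvg_pser_at0 x0 growth_euler x1.
have e0 : euler_coef 0 != 0 by exact: oner_neq0.
have hc : (fun N => qpoch w * (qpoch (w * x ^+ N))^-1) @ \oo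
    --> qpoch w * (euler_coef 0)^-1.
  exact: cvgM (cvg_cst (qpoch w)) (cvgV e0 h).
rewrite [_^-1]invr1 mulr1 in hc.
suff -> : (fun N => \prod_(1 <= n < N.+1) (1 - w * x ^+ n))
   = (fun N => qpoch w * (qpoch (w * x ^+ N))^-1) by exact: hc.
apply/funext => N; rewrite {1}(@funeq_iter qpoch _ N) //.
  by rewrite mulfK // qpoch_neq0 // qdisc.
by move=> v; exact: qpoch_funeq.
Qed.

(* The defect of the equation has the same functional equation as the product
   itself, hence is a multiple of its value at w = 0, which vanishes. *)
Lemma theta_qpoch w : normc (w * x) < 1 ->
  pser (fun n => n%:R * euler_coef n) w = - (qpoch w * lambert 0 w).
Proof.
move=> wx1; apply/eqP; rewrite -addr_eq0; apply/eqP.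
pose H v := pser (fun n => n%:R * euler_coef n) v + qpoch v * lambert 0 v.
have HE v : normc (v * x) < 1 -> H v = (1 - v * x) * H (v * x).
  move=> vx1; rewrite /H (theta_qpoch_funeq vx1) (qpoch_funeq vx1) (lambert_funeq vx1).
  by have := one_sub_neq0 vx1 => h; field.
have c1 := @cvg_pser_at0 _ _ _ w _ x0 (growth_nat x0 growth_euler) x1.
have c2 := @cvg_pser_at0 _ _ _ w _ x0 growth_euler x1.
have c3 := @cvg_pser_at0 _ _ _ w _ x0 (growth_lambert_nat 0) x1.
have c : (fun N => \prod_(1 <= n < N.+1) (1 - w * x ^+ n) * H (w * x ^+ N))
    @ \oo --> qpoch w * (0%:R * euler_coef 0
       + euler_coef 0 * (0%:R ^+ 0 * lambert_coef 0)).
  exact: cvgM (cvg_qpoch wx1) (cvgD c1 (cvgM c2 c3)).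
have e : (fun N => \prod_(1 <= n < N.+1) (1 - w * x ^+ n) * H (w * x ^+ N))
    = fun=> H w.
  by apply/funext => N; rewrite -(funeq_iter _ HE).
rewrite e in c; have := cvg_unique _ (@cvg_cst _ (H w : C) _ \oo _) c.
rewrite -/(H w) => -> //.
by rewrite mul0r add0r /lambert_coef expr0 subrr invr0 !mulr0.
Qed.

End QPochhammer.

(** * Calculus of the operator theta = z d/dz *)

Section Theta.
Variable R : realType.
Local Notation C := (R[i] : numFieldType).
Implicit Types (f g : C -> C) (z u v : C).

(** Differentiability is bundled with the value, since [zddz] also has a value where f is not
    differentiable. *)
Definition has_theta f z v : Prop :=
  exists2 d, is_derive z (1 : C) f d & z * d = v.

Lemma has_theta_zddz f z v : has_theta f z v -> zddz f z = v.
Proof. by move=> [d df <-]; rewrite /zddz derive1E derive_val. Qed.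

Lemma has_theta_near f g z v : (\near z, f z = g z) ->
  has_theta f z v -> has_theta g z v.
Proof. by move=> fg [d df dv]; exists d => //; apply: near_eq_is_derive df. Qed.

Lemma has_theta_cst u z : has_theta (fun=> u) z 0.
Proof. by exists 0; [exact: is_derive_cst|rewrite mulr0]. Qed.

Lemma has_thetaD f g z u v : has_theta f z u -> has_theta g z v ->
  has_theta (fun y => f y + g y) z (u + v).
Proof.
move=> [d df <-] [e dg <-]; exists (d + e); first exact: is_deriveD.
by rewrite mulrDr.
Qed.

Lemma has_thetaM f g z u v : has_theta f z u -> has_theta g z v ->
  has_theta (fun y => f y * g y) z (u * g z + f z * v).
Proof.
move=> [d df <-] [e dg <-]; exists (f z *: e + g z *: d); first exact: is_deriveM.
by rewrite /GRing.scale /=; ring.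
Qed.

Lemma has_thetaZ f z k v : has_theta f z v ->
  has_theta (fun y => k * f y) z (k * v).
Proof. by move=> fv; have := has_thetaM (has_theta_cst k z) fv; rewrite mul0r add0r. Qed.

Lemma has_thetaB f g z u v : has_theta f z u -> has_theta g z v ->
  has_theta (fun y => f y - g y) z (u - v).
Proof.
move=> fu /(has_thetaZ (-1)) gv; have := has_thetaD fu gv.
by rewrite mulN1r; under eq_fun do rewrite mulN1r.
Qed.

Lemma has_theta_sum (I : eqType) (r : seq I) (F : I -> C -> C) (V : I -> C) z :
  (forall i, i \in r -> has_theta (F i) z (V i)) ->
  has_theta (fun y => \sum_(i <- r) F i y) z (\sum_(i <- r) V i).
Proof.
elim: r => [|i r IH] FV.
  rewrite big_nil; under eq_fun do rewrite big_nil.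
  exact: has_theta_cst.
rewrite big_cons; under eq_fun do rewrite big_cons.
apply: has_thetaD; first by apply: FV; rewrite mem_head.
by apply: IH => j jr; apply: FV; rewrite inE jr orbT.
Qed.

Lemma has_thetaV f z v : f z != 0 -> has_theta f z v ->
  has_theta (fun y => (f y)^-1) z (- (v / f z ^+ 2)).
Proof.
move=> fz [d df <-]; exists (- (f z) ^- 2 *: d).
  apply: DeriveDef; first by apply: derivableV => //; exact: ex_derive.
  by rewrite deriveV ?derive_val //; exact: ex_derive.
by rewrite /GRing.scale /=; field.
Qed.

Lemma has_theta_expr z n : has_theta (fun y => y ^+ n) z (n%:R * z ^+ n).
Proof.
exists ((n%:R * z ^+ n.-1) *: 1).
  by have := @is_deriveX _ _ (@id C) n z 1 1 (is_derive_id _ _); rewrite exprfctE.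
by rewrite /GRing.scale /= mulr1; case: n => [|n]; rewrite ?exprS; ring.
Qed.

(** When g is an eigenfunction of theta, as the powers of z are, the chain rule only multiplies by
    the eigenvalue k. *)
Lemma has_theta_comp f g z k v : has_theta g z (k * g z) -> has_theta f (g z) v ->
  has_theta (fun y => f (g y)) z (k * v).
Proof.
move=> [d dg zd] [e df <-]; exists (d * e); last by rewrite mulrA zd mulrA.
have dg' : differentiable g z by apply/derivable1_diffP; exact: ex_derive.
have df' : differentiable f (g z) by apply/derivable1_diffP; exact: ex_derive.
have dfg : differentiable (f \o g) z := differentiable_comp dg' df'.
change (is_derive z (1 : C) (f \o g) (d * e)).
apply: DeriveDef; first exact/derivable1_diffP/dfg.
have dg1 : 'd g z 1 = d := etrans (esym (deriveE (1 : C) dg')) (@derive_val _ _ _ _ _ _ _ dg).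
have df1 : f^`()%classic (g z) = e.
  exact: etrans (derive1E f (g z)) (@derive_val _ _ _ _ _ _ _ df).
apply: etrans (deriveE (1 : C) dfg) _.
apply: etrans (congr1 (fun F => F (1 : C)) (diff_comp dg' df')) _.
apply: etrans (congr1 (fun F => F ('d g z 1)) (diff1E df')) _.
by rewrite dg1 df1.
Qed.

End Theta.

(** * Leibniz' rule for iterated theta-derivatives *)

Section Leibniz.
Variable R : realType.
Local Notation C := (R[i] : numFieldType).
Variables (f : C -> C) (g : nat -> C -> C) (U : set C).
Hypothesis U_open : forall z, U z -> \near z, U z.
Hypothesis theta_f : forall z, U z -> has_theta f z (f z * g 0 z).
Hypothesis theta_g : forall i z, U z -> has_theta (g i) z (g i.+1 z).

Lemma pascal_sum (F G : nat -> C) r :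
  \sum_(i < r.+1) 'C(r, i)%:R * (F (r - i).+1 * G i + F (r - i)%N * G i.+1)
  = \sum_(i < r.+2) 'C(r.+1, i)%:R * (F (r.+1 - i)%N * G i).
Proof.
under eq_bigr do rewrite mulrDr.
rewrite big_split /= [RHS]big_ord_recl /=.
under [X in _ = _ + X]eq_bigr => i _.
  rewrite /bump leq0n add1n binS natrD mulrDl subSS; over.
rewrite big_split /= addrA; congr (_ + _).
rewrite big_ord_recl /= !bin0 !subn0; congr (_ + _).
rewrite big_ord_recr /= bin_small // mul0r addr0.
by apply: eq_bigr => i _; rewrite /bump leq0n add1n subnSK.
Qed.

(** Strong induction: the formula at lower orders holds on all of the open set U, so the iterate
    equals the Leibniz sum near z and that sum may be differentiated. Pascal's rule restores its
    shape. *)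
Lemma theta_leibniz r z : U z ->
  has_theta (iter r (@zddz _) f) z
    (\sum_(i < r.+1) 'C(r, i)%:R * (iter (r - i) (@zddz _) f z * g i z)).
Proof.
elim/ltn_ind: r z => -[|r] IH z Uz.
  by rewrite big_ord1 /= bin0 mul1r; exact: theta_f.
pose S y := \sum_(i < r.+1) 'C(r, i)%:R * (iter (r - i) (@zddz _) f y * g i y).
have FS y : U y -> S y = iter r.+1 (@zddz _) f y.
  by move=> Uy; apply/esym/has_theta_zddz/IH.
apply: (@has_theta_near _ S); first by apply: filterS (U_open Uz) => y; exact: FS.
rewrite -(pascal_sum (fun j => iter j (@zddz _) f z) (g^~ z)).
apply: has_theta_sum => i _.
have Fi : has_theta (iter (r - i) (@zddz _) f) z (iter (r - i).+1 (@zddz _) f z).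
  have h := IH (r - i)%N (leq_subr _ _ : (r - i < r.+1)%N) z Uz.
  by rewrite [iter (r - i).+1 _ _ _](has_theta_zddz h).
have := has_thetaM (has_theta_cst 'C(r, i)%:R z) (has_thetaM Fi (theta_g i Uz)).
by rewrite mul0r add0r.
Qed.

Lemma iter_theta_rec r z : U z -> iter r.+1 (@zddz _) f z
  = \sum_(i < r.+1) 'C(r, i)%:R * (iter (r - i) (@zddz _) f z * g i z).
Proof. by move=> Uz; apply: has_theta_zddz; exact: theta_leibniz. Qed.

End Leibniz.

(** * Logarithmic theta-derivatives *)

Section LogTheta.
Variable R : realType.
Local Notation C := (R[i] : numFieldType).
Implicit Types (f g : C -> C) (z u v x w : C).

Definition has_logtheta f z u : Prop := has_theta f z (f z * u).

Lemma has_logthetaM f g z u v : has_logtheta f z u -> has_logtheta g z v ->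
  has_logtheta (fun y => f y * g y) z (u + v).
Proof.
move=> fu gv; have := has_thetaM fu gv; rewrite /has_logtheta.
by congr has_theta; ring.
Qed.

Lemma has_logtheta_cst w z : has_logtheta (fun=> w) z 0.
Proof. by rewrite /has_logtheta mulr0; exact: has_theta_cst. Qed.

Lemma has_logthetaZ f z u w : has_logtheta f z u ->
  has_logtheta (fun y => w * f y) z u.
Proof. by move=> fu; have := has_logthetaM (has_logtheta_cst w z) fu; rewrite add0r. Qed.

Lemma has_logtheta_prod (I : eqType) (r : seq I) (F : I -> C -> C)
    (V : I -> C) z :
  (forall i, i \in r -> has_logtheta (F i) z (V i)) ->
  has_logtheta (fun y => \prod_(i <- r) F i y) z (\sum_(i <- r) V i).
Proof.
elim: r => [|i r IH] FV.
  rewrite big_nil; under eq_fun do rewrite big_nil.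
  exact: has_logtheta_cst.
rewrite big_cons; under eq_fun do rewrite big_cons.
apply: has_logthetaM; first by apply: FV; rewrite mem_head.
by apply: IH => j jr; apply: FV; rewrite inE jr orbT.
Qed.

Lemma has_logthetaV f z u : f z != 0 -> has_logtheta f z u ->
  has_logtheta (fun y => (f y)^-1) z (- u).
Proof.
move=> fz /(has_thetaV fz); rewrite /has_logtheta.
by congr has_theta; field.
Qed.

Lemma has_logtheta_comp f g z k v : has_theta g z (k * g z) ->
  has_logtheta f (g z) v -> has_logtheta (fun y => f (g y)) z (k * v).
Proof.
by move=> gk fv; have := has_theta_comp gk fv; rewrite /has_logtheta mulrCA.
Qed.

Lemma has_theta_exprV z n : z != 0 ->
  has_theta (fun y => y ^- n) z (- n%:R * z ^- n).
Proof.
move=> z0; have zn : z ^+ n != 0 by rewrite expf_neq0.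
have := @has_thetaV _ (fun y => y ^+ n) z _ zn (has_theta_expr z n).
by congr has_theta; field.
Qed.

Lemma has_logtheta_qpoch x w : normc x < 1 -> normc (w * x) < 1 ->
  has_logtheta (qpoch x) w (- lambert x 0 w).
Proof.
move=> x1 wx1; have h := qdisc_growth wx1.
exists (pser (dpser (euler_coef x)) w).
  exact: is_derive_pser (normc_ge0 x) (growth_euler x1) h.
rewrite (pser_dpser (normc_ge0 x) (growth_euler x1) h) theta_qpoch //.
by rewrite mulrN.
Qed.

Lemma has_theta_lambert x i w : normc x < 1 -> normc (w * x) < 1 ->
  has_theta (lambert x i) w (lambert x i.+1 w).
Proof.
move=> x1 wx1; have h := qdisc_growth wx1.
have g := growth_lambert_nat x1 i.
exists (pser (dpser (fun n => n%:R ^+ i * lambert_coef x n)) w).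
  exact: is_derive_pser (normc_ge0 x) g h.
rewrite (pser_dpser (normc_ge0 x) g h).
apply: (congr1 (fun a : nat -> C => pser a w)).
by apply/funext => n; rewrite exprS mulrA.
Qed.

End LogTheta.

(** * Lambert series *)

Section LambertSeries.
Variable R : realType.
Local Notation C := (R[i] : numFieldType).
Variable q : C.
Hypothesis q1 : normc q < 1.

(** A finite geometric sum in q^d; the last exponent is the least multiple of d above N. *)
Lemma sum_multiples d N : (0 < d)%N ->
  (1 - q ^+ d) * \sum_(1 <= n < N.+1 | (d %| n)%N) q ^+ n
  = q ^+ d - q ^+ (d * (N %/ d).+1).
Proof.
move=> d0; elim: N => [|N IH].
  by rewrite big_geq // mulr0 div0n muln1 subrr.
rewrite big_mkcond big_nat_recr //= -big_mkcond mulrDr IH divnS //.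
case: ifP => [dN|_]; last by rewrite mulr0 addr0.
have -> : q ^+ N.+1 = q ^+ (d * (N %/ d).+1).
  have <- : (N.+1 %/ d = (N %/ d).+1)%N by rewrite divnS // dN.
  by rewrite mulnC divnK.
by rewrite add1n [(d * (N %/ d).+2)%N]mulnS exprD; ring.
Qed.

Lemma sigma_nat j n N : (0 < n <= N)%N ->
  sigma j n = (\sum_(1 <= d < N.+1 | d %| n) d ^ j)%N.
Proof.
move=> /andP[n0 nN]; rewrite /sigma -[in RHS]big_filter; apply: perm_big.
apply: uniq_perm; rewrite ?divisors_uniq ?filter_uniq ?iota_uniq // => d.
rewrite mem_filter mem_index_iota -dvdn_divisors //.
case dn: (d %| n)%N => //=; rewrite ltnS (dvdn_gt0 n0 dn).
by rewrite (leq_trans (dvdn_leq n0 dn) nN).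
Qed.

(** Exchanging n with its divisors d turns the divisor sum into truncated geometric series in q^d;
    the right-hand side collects their tails. *)
Lemma sum_sigma_lambert j N :
  \sum_(1 <= d < N.+1) d%:R ^+ j * (q ^+ d / (1 - q ^+ d))
   - \sum_(1 <= n < N.+1) (sigma j n)%:R * q ^+ n
  = \sum_(1 <= d < N.+1) d%:R ^+ j * (q ^+ (d * (N %/ d).+1) / (1 - q ^+ d)).
Proof.
have -> : \sum_(1 <= n < N.+1) (sigma j n)%:R * q ^+ n
    = \sum_(1 <= d < N.+1) d%:R ^+ j * \sum_(1 <= n < N.+1 | (d %| n)%N) q ^+ n.
  under [RHS]eq_bigr do rewrite mulr_sumr big_mkcond.
  rewrite exchange_big /= [LHS]big_nat [RHS]big_nat; apply: eq_bigr => n nN.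
  rewrite (@sigma_nat j n N) // natr_sum mulr_suml big_mkcond /=.
  by apply: eq_bigr => d _; case: ifP => // _; rewrite natrX.
rewrite -sumrB [LHS]big_nat [RHS]big_nat; apply: eq_bigr => -[|d] //= _.
have h := one_sub_neq0 (normc_expn_lt1 q1 d).
have := sum_multiples N (ltn0Sn d) => /(canRL (mulKf h)) ->.
by rewrite -mulrBr; congr (_ * _); field.
Qed.

Lemma cvg_nat_geometric k : (fun n => n%:R ^+ k * q ^+ n) @ \oo --> (0 : C).
Proof.
have gk : growth (fun n => n%:R ^+ k * 1 : C) 1.
  elim: k => [|k IH].
    move=> s s1; have [M h] := growth_cst (1 : C) s1.
    by exists M => n; rewrite mul1r.
  move=> s s1; have [M h] := growth_nat ler01 IH s1; exists M => n.
  by rewrite exprS -mulrA.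
have q1' : normc q * 1 < 1 by rewrite mulr1.
have c := growth_cvg ler01 gk q1'.
have := cvg_series_cvg_0 (cvgP _ c).
by under eq_fun do rewrite mulr1.
Qed.

Lemma cvg_lambert_sum j :
  (fun N => \sum_(1 <= d < N.+1) d%:R ^+ j * (q ^+ d / (1 - q ^+ d))) @ \oo
    --> lambert q j 1.
Proof.
have c1 : cvg_pser (fun n => n%:R ^+ j * lambert_coef q n) (1 : C).
  apply: growth_cvg (normc_ge0 q) (growth_lambert_nat q1 j) _.
  by rewrite normc1 mul1r.
have := cvg_pserS c1; rewrite -/(lambert q j 1).
suff -> : (fun N => series (fun n => n%:R ^+ j * lambert_coef q n * 1 ^+ n) N.+1)
  = (fun N => \sum_(1 <= d < N.+1) d%:R ^+ j * (q ^+ d / (1 - q ^+ d))) by exact.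
apply/funext => N; rewrite seriesEnat /= big_nat_recl // big_add1 /=.
rewrite /lambert_coef expr0 subrr invr0 !mulr0 mul0r add0r.
by apply: eq_bigr => n _; rewrite expr1n mulr1.
Qed.

(** The exponents in the tails of [sum_sigma_lambert] exceed N, so the N tails add up to at most
    N^(j+1) |q|^N / (1 - |q|), which tends to 0. *)
Lemma cvg_sigma_series j :
  (fun N => \sum_(1 <= n < N.+1) (sigma j n)%:R * q ^+ n) @ \oo --> lambert q j 1.
Proof.
have c3 : (fun N => \sum_(1 <= d < N.+1)
    d%:R ^+ j * (q ^+ (d * (N %/ d).+1) / (1 - q ^+ d))) @ \oo --> (0 : C).
  apply/cvg_normcP => e e0.
  have q1' : 0 < 1 - normc q by rewrite subr_gt0.
  have e1 : 0 < e * (1 - normc q) by rewrite mulr_gt0.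
  have /cvg_normcP/(_ _ e1) := cvg_nat_geometric j.+1; apply: filterS => N.
  rewrite !subr0 normcM !normcX normc_nat -ltr_pdivrMr //; apply: le_lt_trans.
  apply: le_trans (normc_sum _ _ _) _.
  have -> : N%:R ^+ j.+1 * normc q ^+ N / (1 - normc q)
    = \sum_(1 <= d < N.+1) N%:R ^+ j * (normc q ^+ N / (1 - normc q)).
    by rewrite sumr_const_nat subn1 /= -[RHS]mulr_natl exprS !mulrA.
  rewrite big_nat [leRHS]big_nat; apply: ler_sum => -[|d] //= dN.
  rewrite !normcM normcV !normcX normc_nat.
  have q0 := normc_ge0 q.
  apply: ler_pM.
  - by rewrite exprn_ge0 // ler0n.
  - by rewrite mulr_ge0 ?exprn_ge0 // invr_ge0 normc_ge0.
  - by rewrite lerXn2r ?nnegrE ?ler_nat.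
  apply: ler_pM; rewrite ?exprn_ge0 ?invr_ge0 ?normc_ge0 //.
    rewrite ler_wiXn2l ?(ltW q1) // mulnC ltnW //.
    exact: ltn_ceil.
  rewrite lef_pV2 ?posrE //; last first.
    rewrite lt_neqAle normc_ge0 eq_sym normc_eq0.
    by rewrite (one_sub_neq0 (normc_expn_lt1 q1 d)).
  exact: one_sub_normc_le.
have c4 := cvgB (@cvg_lambert_sum j) c3; rewrite subr0 in c4.
suff -> : (fun N => \sum_(1 <= n < N.+1) (sigma j n)%:R * q ^+ n)
  = (fun N => \sum_(1 <= d < N.+1) d%:R ^+ j * (q ^+ d / (1 - q ^+ d))
     - \sum_(1 <= d < N.+1) d%:R ^+ j * (q ^+ (d * (N %/ d).+1) / (1 - q ^+ d))).
  exact: c4.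
by apply/funext => N; rewrite -sum_sigma_lambert subKr.
Qed.

End LambertSeries.

(** * Crank moments *)

Section CrankMoments.
Variable R : realType.
Local Notation C := (R[i] : numFieldType).
Variables (q : C) (t : nat).
Hypothesis q1 : normc q < 1.
Hypothesis t0 : (0 < t)%N.
Hypothesis crank_R_le : forall r, r \in crank_R t -> (0 < r <= t)%N.

Let x : C := q ^+ t.

Let x1 : normc x < 1.
Proof. by rewrite /x -(prednK t0); exact: normc_expn_lt1. Qed.

(** This is |q| < |z| < 1 / |q| without division: an open set around 1, stable under inversion, on
    which both factors of the denominator are nonzero. *)
Definition annulus : set C := [set z | normc (z * q) < 1 /\ normc q < normc z].

Lemma annulus1 : annulus 1.
Proof.
have e : normc (1 : C) = 1 := normc1 R.
by rewrite /annulus; split; rewrite ?mul1r ?e.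
Qed.

Lemma annulus_neq0 z : annulus z -> z != 0.
Proof.
move=> [_]; apply: contraTneq => ->.
by rewrite normc0 -leNgt normc_ge0.
Qed.

Lemma annulusV z : annulus z -> annulus z^-1.
Proof.
move=> Uz; have z0 := annulus_neq0 Uz; case: Uz => zq qz.
have nz : 0 < normc z by apply: le_lt_trans qz; exact: normc_ge0.
rewrite /annulus /= normcM normcV mulrC ltr_pdivrMr // mul1r; split=> //.
by rewrite -[ltRHS]mul1r ltr_pdivlMr // mulrC -normcM.
Qed.

Lemma annulus_open z : annulus z -> \near z, annulus z.
Proof.
move=> [zq qz].
have d0 : 0 < Num.min (1 - normc (z * q)) (normc z - normc q).
  by rewrite lt_min !subr_gt0 zq.
have /cvg_normcP/(_ _ d0) : (id : C -> C) @ z --> z by exact: cvg_id.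
apply: filterS => y; rewrite lt_min => /andP[h1 h2]; split.
  rewrite -[y](subrK z) mulrDl; apply: le_lt_trans (normcD _ _) _.
  have h : normc ((y - z) * q) <= normc (y - z).
    by rewrite normcM ler_piMr ?normc_ge0 // ltW.
  by move: h1 => /= h1; lra.
have := normcD (z - y) y; rewrite subrK.
have -> : normc (z - y) = normc (y - z) by rewrite -[LHS]normc_opp opprB.
by move: h2 => /= h2 h; lra.
Qed.

(** Since r <= t, z^r q^t = (z q)^r q^(t-r), with |z q| < 1. *)
Lemma annulus_expr r z : (0 < r <= t)%N -> annulus z -> normc (z ^+ r * x) < 1.
Proof.
move=> /andP[r0 rt] [zq _].
rewrite /x -(subnKC rt) exprD mulrA -exprMn normcM !normcX.
apply: le_lt_trans (_ : normc (z * q) ^+ r < 1); last first.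
  by rewrite exprn_ilt1 ?normc_ge0 // -lt0n.
by rewrite ler_piMr ?exprn_ge0 ?normc_ge0 // exprn_ile1 ?normc_ge0 // ltW.
Qed.

Lemma annulus_exprV r z : (0 < r <= t)%N -> annulus z -> normc (z ^- r * x) < 1.
Proof. by move=> rt Uz; rewrite -exprVn; apply: annulus_expr (annulusV Uz). Qed.

Definition crank_qpoch (z : C) : C :=
  qpoch q 1 * qpoch x 1 ^+ crank_e t
  * (\prod_(r <- crank_R t) (qpoch x (z ^+ r) * qpoch x (z ^- r)))
  * (qpoch q z * qpoch q z^-1)^-1.

Lemma prod_crank_factor (z : C) N :
  \prod_(1 <= n < N.+1) crank_factor t z q n
  = \prod_(1 <= n < N.+1) (1 - 1 * q ^+ n)
    * (\prod_(1 <= n < N.+1) (1 - 1 * x ^+ n)) ^+ crank_e t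
    * (\prod_(r <- crank_R t) (\prod_(1 <= n < N.+1) (1 - z ^+ r * x ^+ n)
         * \prod_(1 <= n < N.+1) (1 - z ^- r * x ^+ n)))
    * (\prod_(1 <= n < N.+1) (1 - z * q ^+ n)
         * \prod_(1 <= n < N.+1) (1 - z^-1 * q ^+ n))^-1.
Proof.
under [X in _ = _ * X * _]eq_bigr do rewrite -big_split.
rewrite exchange_big /= -prodrXl -!big_split /= -prodfV -!big_split /=.
by apply: eq_bigr => n _; rewrite /crank_factor /x !mul1r -exprM.
Qed.

Lemma cvg_prod_seq (I : eqType) (r : seq I) (F : I -> nat -> C) (l : I -> C) :
  (forall i, i \in r -> F i @ \oo --> l i) ->
  (fun N => \prod_(i <- r) F i N) @ \oo --> \prod_(i <- r) l i.
Proof.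
elim: r => [|i r IH] Fl.
  by rewrite big_nil; under eq_fun do rewrite big_nil; exact: cvg_cst.
rewrite big_cons; under eq_fun do rewrite big_cons.
have Fi := Fl i (mem_head _ _).
have Fr := IH (fun j jr => Fl j (@mem_behead _ (i :: r) j jr)).
exact: cvgM Fi Fr.
Qed.

Lemma cvg_expn (u : nat -> C) (l : C) k : u @ \oo --> l ->
  (fun N => u N ^+ k) @ \oo --> l ^+ k.
Proof.
move=> ul; elim: k => [|k IH].
  by under eq_fun do rewrite expr0; exact: cvg_cst.
rewrite exprS; under eq_fun do rewrite exprS.
exact: cvgM ul IH.
Qed.

Lemma qpoch_annulus_neq0 z : annulus z -> qpoch q z * qpoch q z^-1 != 0.
Proof.
move=> Uz; have [zq _] := Uz; have [zq' _] := annulusV Uz.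
have h1 := qpoch_neq0 q1 zq; have h2 := qpoch_neq0 q1 zq'.
exact: mulf_neq0 h1 h2.
Qed.

Lemma crank_gfE z : annulus z -> crank_gf t z q = crank_qpoch z.
Proof.
move=> Uz; have [zq _] := Uz; have [zq' _] := annulusV Uz.
have [oq _] := annulus1.
have ox : normc (1 * x) < 1 by rewrite mul1r.
rewrite /crank_gf; under eq_fun do rewrite prod_crank_factor.
have c1 := cvg_qpoch q1 oq.
have c2 := @cvg_expn _ _ (crank_e t) (cvg_qpoch x1 ox).
have c3 : (fun N => \prod_(r <- crank_R t)
      (\prod_(1 <= n < N.+1) (1 - z ^+ r * x ^+ n)
        * \prod_(1 <= n < N.+1) (1 - z ^- r * x ^+ n))) @ \oo
    --> \prod_(r <- crank_R t) (qpoch x (z ^+ r) * qpoch x (z ^- r)).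
  apply: cvg_prod_seq => r /crank_R_le rt.
  exact: cvgM (cvg_qpoch x1 (annulus_expr rt Uz)) (cvg_qpoch x1 (annulus_exprV rt Uz)).
have c4 : (fun N => (\prod_(1 <= n < N.+1) (1 - z * q ^+ n)
      * \prod_(1 <= n < N.+1) (1 - z^-1 * q ^+ n))^-1) @ \oo
    --> (qpoch q z * qpoch q z^-1)^-1.
  exact: cvgV (qpoch_annulus_neq0 Uz) (cvgM (cvg_qpoch q1 zq) (cvg_qpoch q1 zq')).
apply: cvg_lim; first exact: norm_hausdorff.
exact: cvgM (cvgM (cvgM c1 c2) c3) c4.
Qed.

(* With theta = z d/dz, this is theta^(i+1) log C(z; q). *)
Definition crank_logtheta (i : nat) (z : C) : C :=
  \sum_(r <- crank_R t) r%:R ^+ i.+1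
     * ((-1) ^+ i * lambert x i (z ^- r) - lambert x i (z ^+ r))
  + (lambert q i z - (-1) ^+ i * lambert q i z^-1).

(** This and the next three identities bring the values produced by the theta rules into the form of
    [crank_logtheta]; the Lambert values are kept abstract. *)
Lemma logtheta_pairE (K : comNzRingType) (r : nat) (a b : K) :
  r%:R ^+ 1 * ((-1) ^+ 0 * b - a) = r%:R * - a + - r%:R * - b.
Proof. by ring. Qed.

Lemma logtheta_quotE (K : comNzRingType) (a b : K) :
  a - (-1) ^+ 0 * b = - (- a + -1 * - b).
Proof. by ring. Qed.

Lemma theta_pairE (K : comNzRingType) (r i : nat) (a b : K) :
  r%:R ^+ i.+1 * ((-1) ^+ i * (- r%:R * b) - r%:R * a)
  = r%:R ^+ i.+2 * ((-1) ^+ i.+1 * b - a).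
Proof. by rewrite [r%:R ^+ i.+2]exprS [(-1) ^+ i.+1]exprS; ring. Qed.

Lemma theta_quotE (K : comNzRingType) (i : nat) (a b : K) :
  a - (-1) ^+ i * (-1 * b) = a - (-1) ^+ i.+1 * b.
Proof. by rewrite exprS; ring. Qed.

Lemma has_logtheta_crank z : annulus z ->
  has_logtheta (fun y => crank_gf t y q) z (crank_logtheta 0 z).
Proof.
move=> Uz; have [zq _] := Uz; have [zq' _] := annulusV Uz.
have z0 := annulus_neq0 Uz.
have tV : has_theta (fun y : C => y^-1) z (-1 * z^-1) := has_theta_exprV 1 z0.
have l2 := has_logtheta_prod (fun r rR => has_logthetaM
  (has_logtheta_comp (has_theta_expr z r)
     (has_logtheta_qpoch x1 (annulus_expr (crank_R_le rR) Uz)))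
  (has_logtheta_comp (has_theta_exprV r z0)
     (has_logtheta_qpoch x1 (annulus_exprV (crank_R_le rR) Uz)))).
have l3 := @has_logthetaV _ (fun y => qpoch q y * qpoch q y^-1) z _
  (qpoch_annulus_neq0 Uz)
  (has_logthetaM (has_logtheta_qpoch q1 zq)
     (has_logtheta_comp tV (has_logtheta_qpoch q1 zq'))).
have l := has_logthetaM (has_logthetaZ (qpoch q 1 * qpoch x 1 ^+ crank_e t) l2) l3.
have e : crank_logtheta 0 z = _ + _ := congr2 +%R
  (eq_bigr _ (fun r _ => logtheta_pairE r _ _)) (logtheta_quotE _ _).
rewrite -e in l.
rewrite /has_logtheta crank_gfE //.
apply: has_theta_near l.
by apply: filterS (annulus_open Uz) => y Uy; rewrite crank_gfE.
Qed.

Lemma has_theta_crank_logtheta i z : annulus z ->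
  has_theta (crank_logtheta i) z (crank_logtheta i.+1 z).
Proof.
move=> Uz; have [zq _] := Uz; have [zq' _] := annulusV Uz.
have z0 := annulus_neq0 Uz.
have tV : has_theta (fun y : C => y^-1) z (-1 * z^-1) := has_theta_exprV 1 z0.
apply: has_thetaD; last first.
  have lq := has_thetaB (has_theta_lambert i q1 zq)
    (has_thetaZ ((-1) ^+ i) (has_theta_comp tV (has_theta_lambert i q1 zq'))).
  exact: eq_ind _ (has_theta _ z) lq _ (theta_quotE i _ _).
apply: has_theta_sum => r /crank_R_le rt.
have l := has_thetaZ (r%:R ^+ i.+1) (has_thetaB
  (has_thetaZ ((-1) ^+ i) (has_theta_comp (has_theta_exprV r z0)
     (has_theta_lambert i x1 (annulus_exprV rt Uz))))
  (has_theta_comp (has_theta_expr z r)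
     (has_theta_lambert i x1 (annulus_expr rt Uz)))).
exact: eq_ind _ (has_theta _ z) l _ (theta_pairE r i _ _).
Qed.

Lemma crank_gf1_neq0 : crank_gf t 1 q != 0.
Proof.
rewrite (crank_gfE annulus1) /crank_qpoch.
have [oq _] := annulus1.
have ox : normc (1 * x) < 1 by rewrite mul1r.
have h1 := qpoch_neq0 q1 oq; have h2 := qpoch_neq0 x1 ox.
apply: mulf_neq0; last by apply: invr_neq0; exact: qpoch_annulus_neq0 annulus1.
apply: mulf_neq0; first exact: mulf_neq0 h1 (expf_neq0 _ h2).
rewrite prodf_seq_neq0; apply/allP => r _; rewrite /= expr1n invr1; exact: (mulf_neq0 h2 h2).
Qed.

Lemma crank_moment0 : crank_moment t 0 q = 1.
Proof. by rewrite /crank_moment /= mulVf // crank_gf1_neq0. Qed.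

Lemma crank_moment_rec r : crank_moment t r.+1 q
  = \sum_(i < r.+1) 'C(r, i)%:R * (crank_moment t (r - i) q * crank_logtheta i 1).
Proof.
rewrite /crank_moment (iter_theta_rec annulus_open has_logtheta_crank
  has_theta_crank_logtheta r annulus1).
rewrite mulr_sumr; apply: eq_bigr => i _.
by rewrite mulrCA !mulrA.
Qed.

(** At z = 1 the arguments z^r and z^-r coincide, so only the parity factor distinguishes their
    contributions. *)
Lemma crank_logtheta1 i : crank_logtheta i 1
  = (1 - (-1) ^+ i) * (lambert q i 1
      - (\sum_(r <- crank_R t) r%:R ^+ i.+1) * lambert x i 1).
Proof.
rewrite /crank_logtheta invr1 mulrBr addrC; congr (_ + _); first by ring.
rewrite mulr_suml mulr_sumr -sumrN; apply: eq_bigr => r _.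
by rewrite expr1n invr1; ring.
Qed.

Lemma crank_logtheta_even i : crank_logtheta (2 * i) 1 = 0.
Proof. by rewrite crank_logtheta1 exprM sqrrN !expr1n subrr mul0r. Qed.

(** For n > 0 this is half of theta^(2n) log C at z = 1; the Bernoulli term cancels the constant
    term of G_2n. *)
Definition crank_cumulant (n : nat) : C :=
  crank_D t (2 * n) q + ratr (bernoulli (2 * n)) / (4 * n)%:R.

Lemma cumulantE (K : comNzRingType) (a b c d : K) :
  (1 - -1) * (a - c * b) = 2 * (- c * b + (- d + a) + d).
Proof. by ring. Qed.

Lemma crank_logtheta_odd i :
  crank_logtheta (2 * i).+1 1 = 2 * crank_cumulant i.+1.
Proof.
have hq : limn (fun N => \sum_(1 <= n < N.+1) (sigma (2 * i).+1 n)%:R * q ^+ n)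
    = lambert q (2 * i).+1 1.
  by apply: cvg_lim; [exact: norm_hausdorff|exact: cvg_sigma_series].
have hx : limn (fun N => \sum_(1 <= m < N.+1)
      (m ^ (2 * i).+1)%:R * (q ^+ (t * m) / (1 - q ^+ (t * m))))
    = lambert x (2 * i).+1 1.
  apply: cvg_lim; first exact: norm_hausdorff.
  suff -> : (fun N => \sum_(1 <= m < N.+1)
      (m ^ (2 * i).+1)%:R * (q ^+ (t * m) / (1 - q ^+ (t * m))))
    = (fun N => \sum_(1 <= m < N.+1) m%:R ^+ (2 * i).+1 * (x ^+ m / (1 - x ^+ m))).
    exact: cvg_lambert_sum.
  by apply/funext => N; apply: eq_bigr => m _; rewrite natrX /x -exprM.
have e2 : (2 * i.+1 = (2 * i).+2)%N by rewrite mulnS.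
(* This matches the constant B_j / (2j) of [eisenstein_G] at j = 2i + 2 with that of the
   cumulant. *)
have e4 : (4 * i.+1 = 2 * (2 * i).+2)%N by rewrite -e2 mulnA.
have od : odd (2 * i).+2 = false by rewrite /= negbK mul2n odd_double.
have sgn : (-1) ^+ (2 * i).+1 = -1 :> C.
  by rewrite exprS exprM sqrrN !expr1n mulr1.
rewrite crank_logtheta1 /crank_cumulant e2 e4 /crank_D /eisenstein_G od.
rewrite /crank_A [(2 * i).+2.-1]/= hq hx sgn.
have -> : \sum_(r <- crank_R t) (r ^ (2 * i).+2)%:R
    = \sum_(r <- crank_R t) r%:R ^+ (2 * i).+2 :> C.
  by apply: eq_bigr => r _; rewrite natrX.
exact: cumulantE.
Qed.

Lemma sum_odd (h : nat -> C) n : (forall i, h (2 * i)%N = 0) ->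
  \sum_(i < 2 * n) h i = \sum_(i < n) h (2 * i).+1.
Proof.
move=> h0; elim: n => [|n IH]; first by rewrite muln0 !big_ord0.
rewrite mulnS add2n !big_ord_recr /= IH h0 addr0.
by [].
Qed.

Lemma crank_moment_even_rec n : crank_moment t (2 * n.+1) q
  = \sum_(k < n.+1) 'C((2 * n).+1, (2 * k).+1)%:R
      * (crank_moment t (2 * (n - k)) q * (2 * crank_cumulant k.+1)).
Proof.
have e : (2 * n.+1 = (2 * n).+2)%N by rewrite mulnS.
rewrite {1}e crank_moment_rec -e (@sum_odd (fun i => 'C((2 * n).+1, i)%:R
  * (crank_moment t ((2 * n).+1 - i) q * crank_logtheta i 1))).
  by apply: eq_bigr => k _; rewrite crank_logtheta_odd subSS -mulnBr.
by move=> i; rewrite crank_logtheta_even !mulr0.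
Qed.

(** From (2j+2)! = 2 (j+1) (2j+1)!, used for n and k. It converts the binomial recurrence into the
    one for the coefficients of X^n / (2n)!. *)
Lemma fact_even_rec (n k : nat) : (k <= n)%N ->
  n.+1%:R / (2 * n.+1)`!%:R * 'C((2 * n).+1, (2 * k).+1)%:R
  = k.+1%:R / (2 * k.+1)`!%:R / (2 * (n - k))`!%:R :> C.
Proof.
move=> kn; have le : ((2 * k).+1 <= (2 * n).+1)%N by rewrite ltnS leq_mul2l.
have bf : 'C((2 * n).+1, (2 * k).+1)%:R
    * (((2 * k).+1)`!%:R * (2 * (n - k))`!%:R) = ((2 * n).+1)`!%:R :> C.
  by rewrite -natrM -natrM mulnBr -[(2 * n - _)%N]subSS bin_fact.
have e j : (2 * j.+1)`!%:R = 2 * j.+1%:R * ((2 * j).+1)`!%:R :> C.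
  have -> : (2 * j.+1)`! = (2 * j.+1 * ((2 * j).+1)`!)%N by rewrite mulnS factS.
  by rewrite natrM natrM.
rewrite (e n) (e k) -bf.
have := fact_neq0 C (2 * n).+1; rewrite -bf !mulf_eq0 !negb_or.
have := @posnatr_neq0 C n.+1 isT; have := @posnatr_neq0 C k.+1 isT.
move: (n.+1%:R) (k.+1%:R) (_`!%:R) (_`!%:R) ('C(_, _)%:R) => x1' x2' x3 x4 x5.
move=> h1 h2 /and3P[h3 h4 h5]; field.
by rewrite h1 h2 h3 h4 h5.
Qed.

Lemma crank_moment_exp_rec n :
  n.+1%:R * (crank_moment t (2 * n.+1) q / (2 * n.+1)`!%:R)
  = \sum_(k < n.+1) k.+1%:R * (2 * crank_cumulant k.+1 / (2 * k.+1)`!%:R)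
      * (crank_moment t (2 * (n - k)) q / (2 * (n - k))`!%:R).
Proof.
rewrite mulrCA crank_moment_even_rec mulr_suml; apply: eq_bigr => -[k kn] _ /=.
have h := @fact_even_rec n k kn.
rewrite [LHS]mulrAC ['C(_, _)%:R * _]mulrC h.
by move: (crank_moment _ _ _) (crank_cumulant _) (_`!%:R) (_`!%:R) => u v w z; ring.
Qed.

Let a n : C := crank_moment t (2 * n) q / (2 * n)`!%:R.
Let b n : C := 2 * crank_cumulant n / (2 * n)`!%:R.

Let a0 : a 0 = 1.
Proof. by rewrite /a muln0 crank_moment0 divr1. Qed.

(** The exponential formula applies with b_k twice the cumulant over (2k)!; this 2 yields the powers
    2^(m_k) in [Psi_T]. *)
Lemma crank_moment_trace s :
  crank_moment t (2 * s) q = part_trace (@Psi_T _ s) crank_cumulant.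
Proof.
have := @exp_partition_sum C a b a0 crank_moment_exp_rec s.
move=> /(congr1 (fun y => (2 * s)`!%:R * y)).
rewrite /a mulrCA mulfV ?fact_neq0 // mulr1 => <-.
rewrite mulr_sumr; apply: eq_bigr => m _; rewrite /Psi_T -mulrA -big_split.
congr (_ * _); apply: eq_bigr => k _ /=.
by rewrite /b !exprMn exprVn invfM; ring.
Qed.

(** The logarithm recovers b_s; the factor (2s)! / 2 of [Psi_V] turns it back into the cumulant. *)
Lemma crank_cumulant_trace s : (0 < s)%N ->
  crank_cumulant s = part_trace (@Psi_V _ s) (fun k => crank_moment t (2 * k) q).
Proof.
move=> s0; have := @log_partition_sum C a b a0 crank_moment_exp_rec s s0.
move=> /(congr1 (fun y => (2 * s)`!%:R / 2 * y)).
have -> : (2 * s)`!%:R / 2 * (2 * crank_cumulant s / (2 * s)`!%:R) = crank_cumulant s.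
  have h := fact_neq0 C (2 * s); move: (_`!%:R) h (crank_cumulant s) => u h v.
  by field; rewrite h.
move=> <-; rewrite mulr_sumr; apply: eq_bigr => m _; rewrite /Psi_V -!mulrA -big_split.
do 4 congr (_ * _); apply: eq_bigr => k _ /=.
by rewrite /a expr_div_n invfM [RHS]mulrC [in RHS](mulrC _^-1) mulrA.
Qed.

End CrankMoments.

(** * The nome lies in the unit disc *)

Section Nome.
Variable R : realType.
Implicit Types tau z : R[i].

Lemma normc_cexp z : normc (cexp z) = expR (complex.Re z).
Proof.
rewrite /cexp normcM /= expr0n /= addr0 cos2Dsin2 sqrtr1 mulr1.
by rewrite sqrtr_sqr ger0_norm // expR_ge0.
Qed.

Lemma normc_nome tau : 0 < complex.Im tau -> normc (nome tau) < 1.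
Proof.
(* The exponent 2 pi i tau has real part - 2 pi b, negative in the upper half-plane. *)
rewrite /nome normc_cexp; case: tau => a b /= b0; rewrite expR_lt1.
have := pi_gt0 R; nra.
Qed.
End Nome.

(** * The trace formulas for the moments and for D *)

Theorem theorem1p6 (R : realType) (tau : R[i]) (Htau : 0 < complex.Im tau)
    (t : nat) (Ht : t \in [:: 5; 7; 11; 17; 19]%N) (s : nat) (Hs : (0 < s)%N) :
  let q := nome tau in
  crank_moment t (2 * s) q =
    part_trace (@Psi_T _ s)
      (fun k => crank_D t (2 * k) q + ratr (bernoulli (2 * k)) / (4 * k)%:R)
  /\
  crank_D t (2 * s) q =
    - (ratr (bernoulli (2 * s)) / (4 * s)%:R)
    + part_trace (@Psi_V _ s) (fun k => crank_moment t (2 * k) q).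
Proof.
have q1 := normc_nome Htau.
have t0 : (0 < t)%N by move: Ht; case: t.
(* The largest exponents 4, 10 and 16 do not exceed 5, 11 and 17, as convergence on the annulus
   requires. *)
have rt r : r \in crank_R t -> (0 < r <= t)%N.
  apply/allP: r; move: Ht; rewrite !inE.
  by case/orP => [|/or4P[]] /eqP ->.
split; first exact: crank_moment_trace.
rewrite -(crank_cumulant_trace q1 t0 rt Hs) /crank_cumulant.
by rewrite addrC addrK.
Qed.
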